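(* Let $f\in R[x]$ be a polynomial with $v(f)=0$. Then an optimal decomposition $f=h^2+g$ with $h,g\in R[x]$ exists and can be computed effectively.
   Context: $R_1$ is a complete discrete valuation ring with quotient field $K_1$ of characteristic $0$ and residue field of characteristic $2$; $K$ is an algebraic closure of $K_1$; $R$ is the integral closure of $R_1$ in $K$, a valuation ring with $\mathbb Q$-valued valuation $v$ normalized by $v(2)=1$. For a Laurent polynomial $f=\sum_i a_ix^i\in K[x^{\pm1}]$ put $v(f):=\inf\{v(a_i)\mid i\in\mathbb Z\}$. For $f\in R[x^{\pm1}]$ with $v(f)=0$ put $$w(f):=\sup\{v(f-h^2)\mid h\in R[x^{\pm1}]\}\in\mathbb R\cup\{\infty\}.$$ A decomposition $f=h^2+g$ with $g,h\in R[x^{\pm1}]$ is called optimal if $v(g)=w(f)$ or $v(g)>2$. *)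

(* Defs.v *)
From HB Require Import structures.
From mathcomp Require Import all_boot all_order all_algebra.
From mathcomp Require Import all_classical all_reals all_analysis.
Set Implicit Arguments.
Unset Strict Implicit.
Unset Printing Implicit Defensive.
Import Order.TTheory GRing.Theory Num.Theory.
Local Open Scope classical_set_scope.
Local Open Scope ring_scope.

Definition uniformizer (A : idomainType) (pi : A) : Prop :=
  [/\ pi != 0, pi \isn't a GRing.unit &
      forall a : A, a != 0 ->
        exists (n : nat) (u : A), u \is a GRing.unit /\ a = u * pi ^+ n].

Definition discrete_valuation_ring (A : idomainType) : Prop :=
  exists pi : A, uniformizer pi.

Definition ring_divides (A : idomainType) (a b : A) : Prop :=
  exists c : A, b = c * a.

(* A maps onto the limit of the A / (pi ^ n).  The kernel of that map is
   automatically zero in a discrete valuation ring. *)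
Definition adically_complete (A : idomainType) : Prop :=
  forall pi : A, uniformizer pi ->
  forall a : nat -> A,
    (forall n, ring_divides (pi ^+ n) (a n.+1 - a n)) ->
    exists l : A, forall n, ring_divides (pi ^+ n) (a n - l).

(* In a local ring the maximal ideal is the set of nonunits; k is the residue
   field, presented as a surjective image of A with that kernel. *)
Definition residue_field_pchar (A : idomainType) (p : nat) : Prop :=
  exists (k : fieldType) (res : {rmorphism A -> k}),
    [/\ forall y : k, exists x : A, res x = y,
        forall x : A, (res x == 0) = (x \isn't a GRing.unit) &
        p \in [pchar k]].

Definition integral_closure (R1 : idomainType) (K : fieldType)
    (iota : {rmorphism {fraction R1} -> K}) : set K :=
  [set x | integralOver (fun a : R1 => iota (FracField.tofrac a)) x].

(* The clauses on v determine it: its valuation ring is R, and v(2) = 1 fixes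
   the scale. *)
Record valued_closure (R1 : idomainType) (K : closedFieldType)
    (iota : {rmorphism {fraction R1} -> K})
    (RR : realType) (v : K -> \bar RR) : Prop := ValuedClosure {
  vc_dvr : discrete_valuation_ring R1;
  vc_complete : adically_complete R1;
  vc_char0 : [pchar {fraction R1}] =i pred0;
  vc_residue2 : residue_field_pchar R1 2;
  vc_algebraic : forall x : K, algebraicOver iota x;
  vc_v0 : v 0 = +oo%E;
  vc_rational : forall x : K, x != 0 -> exists q : rat, v x = (ratr q)%:E;
  vc_vM : forall x y : K, v (x * y) = (v x + v y)%E;
  vc_vD : forall x y : K, (Order.min (v x) (v y) <= v (x + y)%R)%E;
  vc_ring : forall x : K, (0 <= v x)%E <-> integral_closure iota x;
  vc_v2 : v 2%:R = 1%E
}.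

(* A Laurent polynomial is its finitely supported coefficient function. *)
Definition laurent (K : fieldType) (S : set K) : set (int -> K) :=
  [set a | finite_set [set i | a i != 0] /\ forall i, S (a i)].

Definition laurent_mul (K : fieldType) (a b : int -> K) : int -> K :=
  fun n => \sum_(i \in [set: int]) (a i * b (n - i)).

Definition laurent_add (K : fieldType) (a b : int -> K) : int -> K :=
  fun n => a n + b n.

Definition laurent_sub (K : fieldType) (a b : int -> K) : int -> K :=
  fun n => a n - b n.

Definition laurent_of_poly (K : fieldType) (p : {poly K}) : int -> K :=
  fun i => if i is Posz n then p`_n else 0.

Definition laurent_val (K : fieldType) (RR : realType) (v : K -> \bar RR)
    (a : int -> K) : \bar RR :=
  ereal_inf [set v (a i) | i in [set: int]].

Definition square_approx (K : fieldType) (S : set K) (RR : realType)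
    (v : K -> \bar RR) (f : int -> K) : \bar RR :=
  ereal_sup [set laurent_val v (laurent_sub f (laurent_mul h h))
            | h in laurent S].

Definition optimal_decomposition (K : fieldType) (S : set K) (RR : realType)
    (v : K -> \bar RR) (f h g : int -> K) : Prop :=
  [/\ laurent S h, laurent S g,
      f = laurent_add (laurent_mul h h) g &
      laurent_val v g = square_approx S v f \/ (2%:R%:E < laurent_val v g)%E].

(* Effective computability over K is computability by a WHILE program on binary
   trees whose leaves are elements of K.  The primitives are the field
   operations, comparison of valuations, and extraction of a root of a
   univariate polynomial.  The test x = 0 is v(0) <= v(x).  A program contains
   no constant of K except those generated by 1. *)
Inductive data (K : Type) : Type :=
| DNil
| DAtom of K
| DCons of data K & data K.
Arguments DNil {K}.

Inductive expr : Type :=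
| EVar of nat
| ENil
| ECons of expr & expr
| EHead of expr
| ETail of expr
| EOne
| EOpp of expr
| EAdd of expr & expr
| EMul of expr & expr
| EInv of expr
| ERoot of expr
| EValLe of expr & expr.

Inductive command : Type :=
| CAssign of nat & expr
| CSeq of command & command
| CIf of expr & command & command
| CWhile of expr & command.

Fixpoint data_of_seq (K : Type) (s : seq K) : data K :=
  if s is x :: s' then DCons (DAtom x) (data_of_seq s') else DNil.

Fixpoint seq_of_data (K : fieldType) (d : data K) : seq K :=
  if d is DCons a d' then
    (if a is DAtom x then x else 0) :: seq_of_data d'
  else [::].

Definition lift1 (K : Type) (op : K -> K) (a : data K) : data K :=
  if a is DAtom x then DAtom (op x) else DNil.

Definition lift2 (K : Type) (op : K -> K -> K) (a b : data K) : data K :=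
  match a, b with DAtom x, DAtom y => DAtom (op x y) | _, _ => DNil end.

(* Truth is any value other than DNil. *)
Definition truth (K : Type) (d : data K) : bool :=
  if d is DNil then false else true.

Definition store (K : Type) : Type := nat -> data K.

(* The argument of ERoot is the list of coefficients, constant term first. *)
Fixpoint eval (K : fieldType) (vle : rel K) (rt : {poly K} -> K)
    (s : store K) (e : expr) : data K :=
  match e with
  | EVar n => s n
  | ENil => DNil
  | ECons a b => DCons (eval vle rt s a) (eval vle rt s b)
  | EHead a => if eval vle rt s a is DCons x _ then x else DNil
  | ETail a => if eval vle rt s a is DCons _ x then x else DNil
  | EOne => DAtom 1
  | EOpp a => lift1 (@GRing.opp K) (eval vle rt s a)
  | EAdd a b => lift2 (@GRing.add K) (eval vle rt s a) (eval vle rt s b)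
  | EMul a b => lift2 (@GRing.mul K) (eval vle rt s a) (eval vle rt s b)
  | EInv a => lift1 (@GRing.inv K) (eval vle rt s a)
  | ERoot a => DAtom (rt (Poly (seq_of_data (eval vle rt s a))))
  | EValLe a b =>
      match eval vle rt s a, eval vle rt s b with
      | DAtom x, DAtom y => if vle x y then DCons DNil DNil else DNil
      | _, _ => DNil
      end
  end.

Definition update (K : Type) (s : store K) (n : nat) (d : data K) : store K :=
  fun m => if m == n then d else s m.

(* exec vle rt c s s' : started in s, the command c halts in s'. *)
Inductive exec (K : fieldType) (vle : rel K) (rt : {poly K} -> K) :
    command -> store K -> store K -> Prop :=
| exec_assign n e s :
    exec vle rt (CAssign n e) s (update s n (eval vle rt s e))
| exec_seq c1 c2 s1 s2 s3 :
    exec vle rt c1 s1 s2 -> exec vle rt c2 s2 s3 ->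
    exec vle rt (CSeq c1 c2) s1 s3
| exec_if_true e c1 c2 s s' :
    truth (eval vle rt s e) -> exec vle rt c1 s s' ->
    exec vle rt (CIf e c1 c2) s s'
| exec_if_false e c1 c2 s s' :
    ~~ truth (eval vle rt s e) -> exec vle rt c2 s s' ->
    exec vle rt (CIf e c1 c2) s s'
| exec_while_true e c s1 s2 s3 :
    truth (eval vle rt s1 e) -> exec vle rt c s1 s2 ->
    exec vle rt (CWhile e c) s2 s3 ->
    exec vle rt (CWhile e c) s1 s3
| exec_while_false e c s :
    ~~ truth (eval vle rt s e) -> exec vle rt (CWhile e c) s s.

(* Any choice of root is allowed; nothing is required of constant p. *)
Definition root_extraction (K : fieldType) (rt : {poly K} -> K) : Prop :=
  forall p : {poly K}, (1 < size p)%N -> root p (rt p).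

Definition input_store (K : Type) (d : data K) : store K :=
  fun n => if n == 0%N then d else DNil.

(* From the coefficient list of f in variable 0, c halts with a pair of
   coefficient lists of h and g in variable 0; these two lists may have
   trailing zeros. *)
Definition computes (K : fieldType) (vle : rel K) (rt : {poly K} -> K)
    (c : command) (f h g : {poly K}) : Prop :=
  exists (s : store K) (sh sg : seq K),
    [/\ exec vle rt c (input_store (data_of_seq f)) s,
        s 0%N = DCons (data_of_seq sh) (data_of_seq sg),
        Poly sh = h & Poly sg = g].

(* Main.v *)
(* Step 1.  Factor the even part of f as q(x^2), and for each root r of q choose
   s with s^2 = - r.  If w(x) = u(- x), then replacing u by s u + x w replaces w
   by s w - x u and multiplies u^2 + w^2 by x^2 - r.  Adjoining all the roots
   gives h with h^2 and f of the same even part, so g = f - h^2 has only odd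
   exponents.  Squares have no odd coefficients modulo 2, so if v(g) < 2 this is
   optimal, and it remains so when a multiple of 2 is added to h.

   Step 2.  If v(g) >= 2, then a better decomposition is f = (h + 2 e)^2 + g' with
   e (e + h) = g / 4 modulo the maximal ideal.  Let h_n be the first unit
   coefficient of h.  A first unit coefficient e_j shows up in e (e + h) at
   position j + min(j, n), up to the symmetry e -> - e - h when j = n.  Hence
   adding suitable 2 c x^j to h, for j = 0, 1, ..., deg f, clears these positions
   of g / 4 one after the other, and what is left is then optimal.

   A Laurent competitor of h becomes a polynomial after multiplying it by a power
   of x, which shifts f and g by an even number of places. *)
Require Import Defs.
From mathcomp Require Import all_boot all_order all_algebra.
From mathcomp Require Import all_classical all_reals all_analysis.
From mathcomp Require Import zify ring.
Set Implicit Arguments.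
Unset Strict Implicit.
Unset Printing Implicit Defensive.
Import Order.TTheory GRing.Theory Num.Theory.
Local Open Scope classical_set_scope.
Local Open Scope ring_scope.

(** * A functional language and its compilation to WHILE programs *)

(** Iteration occurs only as a fold over a list, so every term has a total value [tev] and its
    compiled program halts. *)
Inductive term : Type :=
| TExpr of expr
| TLet of term & term
| TIf of expr & term & term
| TFold of expr & expr & term
| TCall of term & seq expr.

(** An atom counts as one more pass with empty item and empty rest: it is true for the loop test,
    and [EHead] and [ETail] send it to [DNil]. *)
Fixpoint dfold (K : Type) (F : data K -> data K -> data K -> data K)
    (a l : data K) : data K :=
  match l with
  | DNil => a
  | DAtom _ => F DNil a DNil
  | DCons x l' => dfold F (F l' a x) l'
  end.

Section Semantics.
Variables (K : fieldType) (vle : rel K) (rt : {poly K} -> K).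

(* [EVar i] denotes the i-th value of the environment, counted from the
   outermost binder.  The body of a fold sees the remaining list, the partial
   result and the current item appended to the environment. *)
Fixpoint tev (env : seq (data K)) (t : term) : data K :=
  let ev := Defs.eval vle rt (nth DNil env) in
  match t with
  | TExpr e => ev e
  | TLet t1 t2 => tev (rcons env (tev env t1)) t2
  | TIf e t1 t2 => if truth (ev e) then tev env t1 else tev env t2
  | TFold l a t => dfold (fun r y x => tev (env ++ [:: r; y; x]) t) (ev a) (ev l)
  | TCall t es => tev [seq ev e | e <- es] t
  end.

End Semantics.

(* An environment of size n is stored from variable b on; variables beyond it
   are scratch space, and the result is left in variable b + n. *)
Fixpoint shift (b n : nat) (e : expr) : expr :=
  match e with
  | EVar i => if (i < n)%N then EVar (b + i) else ENil
  | ENil => ENil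
  | ECons e1 e2 => ECons (shift b n e1) (shift b n e2)
  | EHead e => EHead (shift b n e)
  | ETail e => ETail (shift b n e)
  | EOne => EOne
  | EOpp e => EOpp (shift b n e)
  | EAdd e1 e2 => EAdd (shift b n e1) (shift b n e2)
  | EMul e1 e2 => EMul (shift b n e1) (shift b n e2)
  | EInv e => EInv (shift b n e)
  | ERoot e => ERoot (shift b n e)
  | EValLe e1 e2 => EValLe (shift b n e1) (shift b n e2)
  end.

Fixpoint assigns (b n m : nat) (es : seq expr) (k : command) : command :=
  if es is e :: es'
  then CSeq (CAssign (b + m) (shift b n e)) (assigns b n m.+1 es' k)
  else k.

(** In a fold, [b + n], [b + n.+1] and [b + n.+2] hold the remaining list, the partial result and
    the item, so they extend the environment in place. The arguments of a call become the
    environment of a new frame based at [b + n]. *)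
Fixpoint compile (b n : nat) (t : term) : command :=
  match t with
  | TExpr e => CAssign (b + n) (shift b n e)
  | TLet t1 t2 =>
      CSeq (compile b n t1)
        (CSeq (compile b n.+1 t2) (CAssign (b + n) (EVar (b + n.+1))))
  | TIf e t1 t2 => CIf (shift b n e) (compile b n t1) (compile b n t2)
  | TFold l a t =>
      CSeq (CAssign (b + n) (shift b n l))
        (CSeq (CAssign (b + n.+1) (shift b n a))
          (CSeq
            (CWhile (EVar (b + n))
              (CSeq (CAssign (b + n.+2) (EHead (EVar (b + n))))
                (CSeq (CAssign (b + n) (ETail (EVar (b + n))))
                  (CSeq (compile b n.+3 t)
                    (CAssign (b + n.+1) (EVar (b + n.+3)))))))
            (CAssign (b + n) (EVar (b + n.+1)))))
  | TCall t es =>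
      assigns b n n es
        (CSeq (compile (b + n) (size es) t)
          (CAssign (b + n) (EVar (b + n + size es))))
  end.

Section CompilerCorrectness.
Variables (K : fieldType) (vle : rel K) (rt : {poly K} -> K).

Definition holds_env (s : store K) (b : nat) (env : seq (data K)) : Prop :=
  forall i, (i < size env)%N -> s (b + i)%N = nth DNil env i.

Lemma eval_shift (s : store K) b env e : holds_env s b env ->
  Defs.eval vle rt s (shift b (size env) e) = Defs.eval vle rt (nth DNil env) e.
Proof.
move=> senv; elim: e => //=
  [i|? -> ? ->|? ->|? ->|? ->|? -> ? ->|? -> ? ->|? ->|? ->|? -> ? ->] //.
by case: ltnP => [/senv // | /(nth_default DNil)->].
Qed.

Lemma update_eq (s : store K) n d : update s n d n = d.
Proof. by rewrite /update eqxx. Qed.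

Lemma update_neq (s : store K) n d m : m != n -> update s n d m = s m.
Proof. by rewrite /update => /negbTE->. Qed.

Lemma holds_env_eq (s s' : store K) b env :
  (forall i, (i < b + size env)%N -> s' i = s i) ->
  holds_env s b env -> holds_env s' b env.
Proof. by move=> ss' h i lti; rewrite ss' ?h // ltn_add2l. Qed.

Lemma holds_env_rcons (s : store K) b env d :
  holds_env s b env -> s (b + size env)%N = d -> holds_env s b (rcons env d).
Proof.
move=> h sd i; rewrite size_rcons nth_rcons ltnS leq_eqVlt.
by case/orP => [/eqP->|lti]; [rewrite ltnn eqxx | rewrite lti h].
Qed.

(** The targets lie beyond the environment, so no assignment disturbs what the later arguments
    read. *)
Lemma exec_assigns (s : store K) b env es k m :
  holds_env s b env -> (size env <= m)%N ->
  exists s1, [/\ forall s', exec vle rt k s1 s' ->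
                   exec vle rt (assigns b (size env) m es k) s s',
     forall i, (i < size es)%N ->
       s1 (b + m + i)%N = nth DNil [seq Defs.eval vle rt (nth DNil env) e | e <- es] i
   & forall i, (i < b + m)%N -> s1 i = s i].
Proof.
elim: es s m => [|e es IH] s m senv lem /=; first by exists s.
have senv' : holds_env (update s (b + m)%N (Defs.eval vle rt s (shift b (size env) e))) b env.
  by apply: holds_env_eq senv => i lti; rewrite update_neq //; lia.
have [s1 [ex vals old]] := IH _ m.+1 senv' (leqW lem).
exists s1; split=> [s' /ex|i|i lti].
- by apply: exec_seq; apply: exec_assign.
- case: i => [|i] /= lti; last by rewrite -(vals i) // !addnS addSn.
  by rewrite addn0 old ?addnS // update_eq eval_shift.
- by rewrite old ?update_neq //; lia.
Qed.

(** The last clause carries the induction: a subprogram touches only scratch variables, so the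
    values of the enclosing binders survive it. *)
Lemma compile_correct t b env (s : store K) : holds_env s b env ->
  exists s', [/\ exec vle rt (compile b (size env) t) s s',
    s' (b + size env)%N = tev vle rt env t
  & forall i, (i < b + size env)%N -> s' i = s i].
Proof.
elim: t b env s => /= [e|t1 IH1 t2 IH2|e t1 IH1 t2 IH2|l a t IH|t IH es] b env s senv.
- exists (update s (b + size env)%N (Defs.eval vle rt s (shift b (size env) e))).
  split; [exact: exec_assign | by rewrite update_eq eval_shift|].
  by move=> i lti; rewrite update_neq //; lia.
- have [s1 [ex1 val1 old1]] := IH1 b env s senv.
  have senv1 := holds_env_rcons (holds_env_eq old1 senv) val1.
  have [s2 [+ val2 old2]] := IH2 _ _ _ senv1.
  rewrite size_rcons in val2 old2 * => ex2; eexists; split.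
  + by apply: exec_seq ex1 _; apply: exec_seq ex2 _; apply: exec_assign.
  + by rewrite update_eq /=.
  + by move=> i lti; rewrite update_neq ?old2 ?old1 //; lia.
- case te : (truth (Defs.eval vle rt (nth DNil env) e)).
  + have [s1 [ex1 val1 old1]] := IH1 _ _ _ senv; exists s1; split=> //.
    by apply: exec_if_true ex1; rewrite eval_shift.
  + have [s1 [ex1 val1 old1]] := IH2 _ _ _ senv; exists s1; split=> //.
    by apply: exec_if_false ex1; rewrite eval_shift // te.
- set n := size env; set F := fun r y x : data K => tev vle rt (env ++ [:: r; y; x]) t.
  set body := CSeq (CAssign (b + n.+2) _) _.
  have loop d : forall y (s1 : store K), holds_env s1 b env ->
      s1 (b + n)%N = d -> s1 (b + n.+1)%N = y ->
      exists s2, [/\ exec vle rt (CWhile (EVar (b + n)) body) s1 s2,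
        s2 (b + n.+1)%N = dfold F y d
      & forall i, (i < b + n)%N -> s2 i = s1 i].
    (* One pass, with head and tail given as matches so that it covers an atom as well as a pair. *)
    have step y (s1 : store K) r x : holds_env s1 b env ->
        s1 (b + n.+1)%N = y ->
        (if s1 (b + n)%N is DCons z _ then z else DNil) = x ->
        (if s1 (b + n)%N is DCons _ z then z else DNil) = r ->
        exists s2, [/\ exec vle rt body s1 s2, s2 (b + n)%N = r,
          s2 (b + n.+1)%N = F r y x & forall i, (i < b + n)%N -> s2 i = s1 i].
      move=> senv1 s1y s1x s1r.
      set s3 := update s1 (b + n.+2)%N x; set s4 := update s3 (b + n)%N r.
      have old4 i : (i < b + n)%N -> s4 i = s1 i.
        by move=> lti; rewrite /s4 /s3 !update_neq //; lia.
      have senv4 : holds_env s4 b (env ++ [:: r; y; x]).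
        move=> i; rewrite size_cat nth_cat /=.
        case: (ltnP i (size env)) => [lti _|lei lti].
          by rewrite old4 ?senv1 // ltn_add2l.
        rewrite -(subnKC lei) -/n addKn.
        have: (i - n < 3)%N by rewrite /n; lia.
        rewrite addnA /s4 /s3 /update; case: (i - n)%N => [|[|[|//]]] _ /=.
        + by rewrite addn0 eqxx.
        + rewrite addn1 ifN ?ifN -?addnS //; lia.
        + by rewrite addn2 ifN -?addnS ?eqxx //; lia.
      have [s5 [ex5 val5 old5]] := IH _ _ _ senv4.
      move: ex5 val5 old5; rewrite size_cat addn3 -/n => ex5 val5 old5.
      exists (update s5 (b + n.+1)%N (s5 (b + n.+3)%N)); split.
      + apply: exec_seq (exec_assign _ _ _ _ _) _.
        apply: exec_seq (exec_assign _ _ _ _ _) _.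
        rewrite /= s1x -/s3; have -> : s3 (b + n)%N = s1 (b + n)%N.
          by rewrite /s3 update_neq //; lia.
        by rewrite s1r; apply: exec_seq ex5 (exec_assign _ _ _ _ _).
      + by rewrite update_neq ?old5 /s4 ?update_eq //; lia.
      + by rewrite update_eq val5.
      + by move=> i lti; rewrite update_neq ?old5 ?old4 //; lia.
    elim: d => [|x|x _ d IHd] y s1 senv1 s1d s1y.
    + by exists s1; split=> //; apply: exec_while_false; rewrite /= s1d.
    + have [|//|s2 [ex2 s2d s2y old2]] := step y s1 DNil DNil senv1 s1y.
        by rewrite s1d.
        by rewrite s1d.
      exists s2; split=> //; apply: exec_while_true ex2 _; first by rewrite /= s1d.
      by apply: exec_while_false; rewrite /= s2d.
    + have [||s2 [ex2 s2d s2y old2]] := step y s1 d x senv1 s1y.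
        by rewrite s1d.
        by rewrite s1d.
      have [s3 [ex3 s3y old3]] := IHd _ s2 (holds_env_eq old2 senv1) s2d s2y.
      exists s3; split=> //; first by apply: exec_while_true ex2 ex3; rewrite /= s1d.
      by move=> i lti; rewrite old3 ?old2.
  set d := Defs.eval vle rt (nth DNil env) l; set y := Defs.eval vle rt (nth DNil env) a.
  set s1 := update s (b + n)%N d; set s2 := update s1 (b + n.+1)%N y.
  have old1 i : (i < b + n)%N -> s1 i = s i.
    by move=> lti; rewrite /s1 !update_neq //; lia.
  have old2 i : (i < b + n)%N -> s2 i = s i.
    by move=> lti; rewrite /s2 !update_neq ?old1 //; lia.
  have [||s3 [ex3 val3 old3]] := loop d y s2 (holds_env_eq old2 senv).
  + by rewrite /s2 update_neq /s1 ?update_eq //; lia.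
  + by rewrite /s2 update_eq.
  exists (update s3 (b + n)%N (s3 (b + n.+1)%N)); split.
  + apply: exec_seq (exec_assign _ _ _ _ _) _.
    rewrite eval_shift // -/d -/s1; apply: exec_seq (exec_assign _ _ _ _ _) _.
    rewrite (eval_shift _ (holds_env_eq old1 senv)) -/y -/s2.
    by apply: exec_seq ex3 (exec_assign _ _ _ _ _).
  + by rewrite update_eq.
  + by move=> i lti; rewrite update_neq ?old3 ?old2 //; lia.
- set vals := [seq _ | e <- es].
  have [s1 [ex1 val1 old1]] := exec_assigns es
    (CSeq (compile (b + size env) (size es) t)
          (CAssign (b + size env) (EVar (b + size env + size es)))) senv (leqnn _).
  have senv1 : holds_env s1 (b + size env) vals.
    by move=> i; rewrite size_map => /val1.
  have [s2 []] := IH _ _ _ senv1.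
  rewrite size_map => ex2 val2 old2.
  exists (update s2 (b + size env)%N (s2 (b + size env + size es)%N)); split.
  + by apply: ex1; apply: exec_seq ex2 (exec_assign _ _ _ _ _).
  + by rewrite update_eq.
  + by move=> i lti; rewrite update_neq ?old2 ?old1 //; lia.
Qed.

End CompilerCorrectness.
(** * Valuations with v(2) = 1 and coefficients of products *)

Record dyadic_valuation (K : fieldType) (RR : realType) (v : K -> \bar RR) :
    Prop := DyadicValuation {
  dv_0 : v 0 = +oo%E;
  dv_fin : forall x, x != 0 -> exists r : RR, v x = r%:E;
  dv_M : forall x y, v (x * y) = (v x + v y)%E;
  dv_D : forall x y, (Order.min (v x) (v y) <= v (x + y)%R)%E;
  dv_2 : v 2%:R = 1%E
}.

Definition vring (K : fieldType) (RR : realType) (v : K -> \bar RR) (x : K) :=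
  (0 <= v x)%E.

(** Strict inequalities of valuations become membership of a quotient in this maximal ideal, to be
    handled like congruences. *)
Definition vmax (K : fieldType) (RR : realType) (v : K -> \bar RR) (x : K) :=
  (0 < v x)%E.

Section ValuationRing.
Variables (K : fieldType) (RR : realType) (v : K -> \bar RR).
Hypothesis hv : dyadic_valuation v.

Local Notation O := (vring v).
Local Notation M := (vmax v).

Lemma v_1 : v 1 = 0%E.
Proof.
have [r vr] := dv_fin hv (oner_neq0 K).
have := dv_M hv 1 1; rewrite mulr1 vr => -[/eqP].
by rewrite -subr_eq0 opprD addrA subrr add0r oppr_eq0 => /eqP->.
Qed.

Lemma v_opp x : v (- x) = v x.
Proof.
rewrite -mulN1r (dv_M hv).
suff -> : v (- 1) = 0%E by rewrite add0e.
have [|r vr] := dv_fin hv (x := -1); first by rewrite oppr_eq0 oner_eq0.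
have := dv_M hv (-1) (-1); rewrite mulrNN mulr1 v_1 vr => -[/esym/eqP].
by rewrite -mulr2n mulrn_eq0 /= => /eqP->.
Qed.

Lemma v_fine x : x != 0 -> v x = (fine (v x))%:E.
Proof. by move=> /(dv_fin hv)[r ->]. Qed.

Lemma v_inv x : x != 0 -> v x^-1 = (- v x)%E.
Proof.
move=> x0; have := dv_M hv x x^-1; rewrite divff // v_1.
rewrite (v_fine x0) (v_fine (x := x^-1)) ?invr_eq0 // => -[/esym/eqP].
by rewrite addrC addr_eq0 => /eqP->.
Qed.

Lemma v_leE (x y : K) : y != 0 -> (v y <= v x)%E = O (x / y).
Proof.
move=> y0; rewrite /vring (dv_M hv) (v_inv y0); have [s ->] := dv_fin hv y0.
have [->|/(dv_fin hv)[r ->]] := eqVneq x 0; last by rewrite !lee_fin subr_ge0.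
by rewrite (dv_0 hv) addye //= ?leey ?ltey.
Qed.

Lemma v_ltE (x y : K) : y != 0 -> (v y < v x)%E = M (x / y).
Proof.
move=> y0; rewrite /vmax (dv_M hv) (v_inv y0); have [s ->] := dv_fin hv y0.
have [->|/(dv_fin hv)[r ->]] := eqVneq x 0; last by rewrite !lte_fin subr_gt0.
by rewrite (dv_0 hv) addye //= ?leey ?ltey.
Qed.

Lemma O_0 : O 0. Proof. by rewrite /vring (dv_0 hv) leey. Qed.
Lemma M_0 : M 0. Proof. by rewrite /vmax (dv_0 hv) ltey. Qed.
Lemma O_1 : O 1. Proof. by rewrite /vring v_1. Qed.
Lemma M_1 : ~~ M 1. Proof. by rewrite /vmax v_1 ltxx. Qed.
Lemma M_2 : M 2%:R. Proof. by rewrite /vmax (dv_2 hv) lte_fin ltr01. Qed.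
Lemma MO x : M x -> O x. Proof. exact: ltW. Qed.

Lemma O_add x y : O x -> O y -> O (x + y).
Proof. by move=> Ox Oy; apply: le_trans (dv_D hv _ _); rewrite le_min; apply/andP. Qed.

Lemma M_add x y : M x -> M y -> M (x + y).
Proof. by move=> Mx My; apply: lt_le_trans (dv_D hv _ _); rewrite lt_min; apply/andP. Qed.

Lemma O_opp x : O (- x) = O x. Proof. by rewrite /vring v_opp. Qed.
Lemma M_opp x : M (- x) = M x. Proof. by rewrite /vmax v_opp. Qed.

Lemma O_sub x y : O x -> O y -> O (x - y).
Proof. by move=> Ox Oy; apply: O_add; rewrite ?O_opp. Qed.

Lemma M_sub x y : M x -> M y -> M (x - y).
Proof. by move=> Ox Oy; apply: M_add; rewrite ?M_opp. Qed.

Lemma O_mul x y : O x -> O y -> O (x * y).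
Proof. by rewrite /vring (dv_M hv); apply: adde_ge0. Qed.

Lemma M_mulr x y : O x -> M y -> M (x * y).
Proof.
rewrite /vmax /vring (dv_M hv) => Ox My.
exact: lt_le_trans My (leeDr _ Ox).
Qed.

Lemma M_mull x y : M x -> O y -> M (x * y).
Proof. by rewrite mulrC => Mx Oy; apply: M_mulr. Qed.

Lemma O_sum (I : Type) (r : seq I) (P : pred I) (F : I -> K) :
  (forall i, P i -> O (F i)) -> O (\sum_(i <- r | P i) F i).
Proof. by apply: (big_ind (fun x => O x)); [exact: O_0 | exact: O_add]. Qed.

Lemma M_sum (I : Type) (r : seq I) (P : pred I) (F : I -> K) :
  (forall i, P i -> M (F i)) -> M (\sum_(i <- r | P i) F i).
Proof. by apply: (big_ind (fun x => M x)); [exact: M_0 | exact: M_add]. Qed.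

Lemma notM_neq0 x : ~~ M x -> x != 0.
Proof. by apply: contraNneq => ->; apply: M_0. Qed.

Lemma O_inv x : ~~ M x -> O x^-1.
Proof.
move=> nMx; have x0 := notM_neq0 nMx.
by rewrite /vring v_inv // leeNr oppe0 leNgt.
Qed.

Lemma notO_neq0 x : ~~ O x -> x != 0.
Proof. by apply: contraNneq => ->; apply: O_0. Qed.

Lemma M_inv x : ~~ O x -> M x^-1.
Proof.
move=> nOx; have x0 := notO_neq0 nOx.
by rewrite /vmax v_inv // lteNr oppe0 ltNge.
Qed.

Lemma M_prime x y : O x -> O y -> M (x * y) -> M x || M y.
Proof.
move=> Ox Oy Mxy; case: (boolP (M x)) => //= nMx.
by rewrite -[y](mulKf (notM_neq0 nMx)) M_mulr // O_inv.
Qed.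

Lemma M_eqmod x y : M (x - y) -> M x = M y.
Proof.
move=> Mxy; apply/idP/idP => [Mx|My].
  by rewrite -[y](subKr x) M_sub.
by rewrite -(subrK y x) M_add.
Qed.

Lemma O_total x y : x != 0 -> y != 0 -> O (x / y) || O (y / x).
Proof. by move=> x0 y0; rewrite -!v_leE // le_total. Qed.

Lemma two_neq0 : 2%:R != 0 :> K.
Proof. by apply/eqP => h; have := dv_2 hv; rewrite h (dv_0 hv). Qed.

(** If x^-1 were in the maximal ideal, dividing [x * x + b * x] by x^2 would put 1 there. *)
Lemma O_sqr x b : O b -> O (x * x + b * x) -> O x.
Proof.
move=> Ob; apply: contraLR => nOx; have x0 := notO_neq0 nOx.
have Mx := M_inv nOx; apply/negP => h; move: M_1; apply/negP/negPn.
have -> : 1 = x^-1 * x^-1 * (x * x + b * x) - b * x^-1 by field.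
by apply: M_sub; [do 2!apply: M_mull => //; apply: MO | apply: M_mulr].
Qed.

Lemma O_nat n : O n%:R.
Proof. by elim: n => [|n IH]; rewrite ?O_0 // mulrS O_add ?O_1. Qed.

Definition PO (p : {poly K}) := forall i, O p`_i.
Definition PM (p : {poly K}) := forall i, M p`_i.

Lemma PO_add p q : PO p -> PO q -> PO (p + q).
Proof. by move=> Op Oq i; rewrite coefD O_add. Qed.

Lemma PO_opp p : PO p -> PO (- p).
Proof. by move=> Op i; rewrite coefN O_opp. Qed.

Lemma PO_sub p q : PO p -> PO q -> PO (p - q).
Proof. by move=> Op Oq; apply: PO_add => //; apply: PO_opp. Qed.

Lemma PO_mul p q : PO p -> PO q -> PO (p * q).
Proof. by move=> Op Oq i; rewrite coefM O_sum // => j _; rewrite O_mul. Qed.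

Lemma PO_scale c p : O c -> PO p -> PO (c *: p).
Proof. by move=> Oc Op i; rewrite coefZ O_mul. Qed.

Lemma PO_X n : PO 'X^n.
Proof. by move=> i; rewrite coefXn O_nat. Qed.

Lemma PM_mul p q : PM p -> PO q -> PM (p * q).
Proof. by move=> Mp Oq i; rewrite coefM M_sum // => j _; rewrite M_mull. Qed.

(** Squaring is additive modulo 2; the cross terms are collected in [r], which stays integral. *)
Lemma sqr_coef (p : {poly K}) : PO p -> exists r : {poly K}, PO r /\ forall k,
  (p * p)`_k = (if odd k then 0 else p`_k./2 * p`_k./2) + 2%:R * r`_k.
Proof.
elim/poly_ind: p => [|p c IH] Op.
  exists 0; split=> [i|k]; first by rewrite coef0 O_0.
  by rewrite mul0r !coef0 !mulr0 if_same addr0.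
have Oc : O c by have := Op 0%N; rewrite coefD coefMX coefC add0r.
have Opp : PO p by move=> i; have := Op i.+1; rewrite coefD coefMX coefC addr0.
have [r [Or Er]] := IH Opp.
exists (r * 'X^2 + c *: (p * 'X)); split.
  apply: PO_add; first by apply: PO_mul => //; apply: PO_X.
  by apply: PO_scale => //; apply: PO_mul => //; apply: (PO_X 1).
move=> k.
have -> : (p * 'X + c%:P) * (p * 'X + c%:P) =
  (p * p) * 'X^2 + (c%:P * c%:P) + 2%:R * (c%:P * (p * 'X)) by ring.
rewrite -polyCM !coefD.
have -> : (2%:R * (c%:P * (p * 'X)))`_k = 2%:R * (c *: (p * 'X))`_k :> K.
  by rewrite mul_polyC -(polyC_natr _ 2) mul_polyC !coefZ.
rewrite !coefMXn coefC; case: k => [|[|k]] /=.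
- by rewrite coefMX coefC /= add0r; ring.
- by ring.
- by rewrite !subSS subn0 Er negbK coefMX coefC /= !addr0; case: odd; ring.
Qed.

Lemma min_coef (p : {poly K}) : p != 0 ->
  exists i, p`_i != 0 /\ forall k, O (p`_k / p`_i).
Proof.
elim/poly_ind: p => [|p c IH]; first by rewrite eqxx.
have [-> | p0 _] := eqVneq p 0.
  rewrite mul0r add0r polyC_eq0 => c0; exists 0%N; rewrite coefC; split=> // k.
  by rewrite coefC; case: eqP; rewrite ?mul0r ?O_0 // divff // O_1.
have [i [pi0 imin]] := IH p0.
have coefS k : (p * 'X + c%:P)`_k.+1 = p`_k by rewrite coefD coefMX coefC addr0.
have coef0 : (p * 'X + c%:P)`_0 = c by rewrite coefD coefMX coefC add0r.
case: (boolP (O (c / p`_i))) => hc.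
  by exists i.+1; rewrite coefS; split=> // -[|k]; rewrite ?coef0 ?coefS.
have c0 : c != 0 by apply: contraNneq hc => ->; rewrite mul0r O_0.
have hpc : O (p`_i / c) by have := O_total pi0 c0; rewrite (negbTE hc) orbF.
exists 0%N; rewrite coef0; split=> // -[|k]; first by rewrite coef0 divff ?O_1.
rewrite coefS; have -> : p`_k / c = (p`_k / p`_i) * (p`_i / c) by field; apply/andP.
by rewrite O_mul.
Qed.

(* The coefficient of [p * p] at twice the position of a coefficient of [p] of
   minimal valuation is, modulo 2, a square, so nothing cancels it. *)
Lemma PO_sqr (p b : {poly K}) : PO b ->
  (forall k, O (p * p + b * p)`_(k.*2)) -> PO p.
Proof.
move=> Ob h i0; apply/negPn/negP => nO.
have p0 : p != 0 by apply: contraNneq nO => ->; rewrite coef0 O_0.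
have [i [pi0 imin]] := min_coef p0; set d := p`_i in pi0 imin.
have nOd : ~~ O d.
  by apply: contra nO => Od; rewrite -(divfK pi0 p`_i0) O_mul.
have Md := M_inv nOd.
have Op1 : PO (d^-1 *: p) by move=> k; rewrite coefZ mulrC.
have [r [Or Er]] := sqr_coef Op1.
move: M_1; apply/negP/negPn.
have -> : 1 = (d^-1 *: p * (d^-1 *: p))`_i.*2 - 2%:R * r`_i.*2.
  by rewrite Er odd_double doubleK coefZ mulVf // mulr1 addrK.
have -> : (d^-1 *: p * (d^-1 *: p))`_i.*2 =
    d^-1 * d^-1 * (p * p + b * p)`_i.*2 - d^-1 * (b * (d^-1 *: p))`_i.*2.
  rewrite -!scalerAr -scalerAl !coefZ coefD; ring.
apply: M_sub; last by apply: M_mull M_2 _.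
apply: M_sub; first by do 2!apply: M_mull => //; apply: MO.
by apply: M_mull => //; apply: PO_mul.
Qed.

Lemma coefM_eqmod (p q : {poly K}) a b : PO p -> PO q ->
  (forall k, (k <= a + b)%N -> k != a -> M p`_k \/ M q`_(a + b - k)) ->
  M ((p * q)`_(a + b) - p`_a * q`_b).
Proof.
move=> Op Oq h.
have lta : (a < (a + b).+1)%N by rewrite ltnS leq_addr.
rewrite coefM (bigD1 (Ordinal lta)) //= addKn addrAC subrr add0r M_sum // => k nk.
by case: (h k _ nk) => [|Mk|Mk]; [rewrite -ltnS | apply: M_mull | apply: M_mulr].
Qed.

Lemma coefM_low (p q : {poly K}) a b : PO p -> PO q ->
  (forall k, (k < a)%N -> M p`_k) -> (forall k, (k < b)%N -> M q`_k) ->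
  M ((p * q)`_(a + b) - p`_a * q`_b).
Proof.
move=> Op Oq ha hb; apply: coefM_eqmod => // k lek nk.
by case: (ltnP k a) => [/ha|lea]; [left | right; apply: hb; lia].
Qed.

Lemma coefM_high (p q : {poly K}) a b : PO p -> PO q ->
  (forall k, (a < k)%N -> M p`_k) -> (forall k, (b < k)%N -> M q`_k) ->
  M ((p * q)`_(a + b) - p`_a * q`_b).
Proof.
move=> Op Oq ha hb; apply: coefM_eqmod => // k lek nk.
by case: (ltnP a k) => [/ha|lea]; [left | right; apply: hb; lia].
Qed.

End ValuationRing.
(** * Criteria for optimality *)

Section Optimality.
Variables (K : fieldType) (RR : realType) (v : K -> \bar RR).
Hypothesis hv : dyadic_valuation v.

Local Notation O := (vring v).
Local Notation M := (vmax v).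

Lemma M_sqr x : M (x * x) -> M x.
Proof.
move=> Mxx; apply/negPn/negP => nMx; have x0 := notM_neq0 hv nMx.
have := M_mulr hv (O_mul hv (O_inv hv nMx) (O_inv hv nMx)) Mxx.
have -> : x^-1 * x^-1 * (x * x) = 1 by field.
by apply/negP/(M_1 hv).
Qed.

Lemma four_neq0 : 4%:R != 0 :> K.
Proof. by rewrite (natrM _ 2 2) mulf_neq0 ?(two_neq0 hv). Qed.

(* Modulo 2 the square of a polynomial has no odd coefficients, so it cannot
   cancel a dominant odd coefficient of [g]. *)
Lemma odd_optimal (h g H : {poly K}) k (a : K) : PO v h ->
  odd k -> a * a = g`_k -> g`_k != 0 -> M (4%:R / g`_k) ->
  (forall i, O (g`_i / g`_k)) ->
  ~ (forall i, M ((h * h + g - H * H)`_i / g`_k)).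
Proof.
move=> Oh oddk aa gk0 M4 gmin better.
have a0 : a != 0 by apply: contraNneq gk0 => a0; rewrite -aa a0 mul0r.
(* Since v(g_k) < 2, its square root [a] has v(a) < 1. *)
have M2a : M (2%:R / a).
  apply: M_sqr; have -> : 2%:R / a * (2%:R / a) = 4%:R / (a * a) by field.
  by rewrite aa.
(* The two remainders differ by (H - h)^2 + 2 h (H - h); division by g_k = a^2 turns this into d^2 +
   b d, where b is small because v(a) < 1. *)
pose d : {poly K} := a^-1 *: (H - h); pose b : {poly K} := (2%:R / a) *: h.
have Ob : PO v b by apply: PO_scale => //; apply: MO.
have Ed : d * d + b * d = (g`_k)^-1 *: (g - (h * h + g - H * H)).
  rewrite /d /b -aa -!scalerAr -!scalerAl !scalerA.
  have -> : a^-1 * a^-1 = (a * a)^-1 by field.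
  have -> : a^-1 * (2%:R / a) = (a * a)^-1 * 2%:R by field.
  rewrite -!scalerA -scalerDr; congr (_ *: _).
  by rewrite scaler_nat; ring.
have coefEd i : (d * d + b * d)`_i = g`_i / g`_k - (h * h + g - H * H)`_i / g`_k.
  by rewrite Ed coefZ coefB mulrC mulrBl.
have Od : PO v d.
  by apply: (PO_sqr hv Ob) => i; rewrite coefEd; apply: O_sub => //; apply: MO.
have [r [Or Er]] := sqr_coef hv Od.
have := coefEd k; rewrite coefD Er oddk add0r divff // => E1.
move: (M_1 hv); apply/negP/negPn.
have -> : 1 = 2%:R * r`_k + (b * d)`_k + (h * h + g - H * H)`_k / g`_k :> K.
  by rewrite E1 subrK.
apply: M_add (better k) => //; apply: M_add => //; first exact: M_mull (M_2 hv) _.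
by rewrite /b -scalerAl coefZ; apply: M_mull => //; apply: PO_mul.
Qed.

(** A first unit coefficient of [a] at i <= J would meet the unit b_n and show up in the product at
    i + n. A last one at m > J would be shared by [b], and its square would show up at 2 m > 2 J. *)
Lemma factor_small (a b : {poly K}) n J : PO v a -> PO v b ->
  (forall i, (i <= n)%N -> M a`_i) -> (forall i, (i < n)%N -> M b`_i) ->
  ~~ M b`_n -> (forall i, (J < i)%N -> b`_i = a`_i) ->
  (forall i, (n < i <= J)%N -> M (a * b)`_(i + n)) ->
  (forall i, (J.*2 < i)%N -> M (a * b)`_i) -> PM v a.
Proof.
move=> Oa Ob lowa lowb nMb hab clean high.
have smallJ i : (i <= J)%N -> M a`_i.
  elim/ltn_ind: i => i IH leiJ; have [/lowa //|ltni] := leqP i n.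
  apply/negPn/negP => nMa.
  have lowi k : (k < i)%N -> M a`_k.
    by move=> ltk; apply: IH => //; apply: leq_trans (ltnW ltk) leiJ.
  have := coefM_low hv Oa Ob lowi lowb; move/(M_eqmod hv); rewrite clean ?ltni // => /esym Mab.
  by have := M_prime hv (Oa i) (Ob n) Mab; rewrite (negbTE nMa) (negbTE nMb).
move=> i; apply/negPn/negP => nMai.
have bound k : ~~ M a`_k -> (k <= size a)%N.
  rewrite leqNgt; apply: contra => /ltnW lek.
  by rewrite nth_default // (M_0 hv).
have [m nMm maxm] := ex_maxnP (ex_intro (fun k => ~~ M a`_k) i nMai) bound.
have ltJm : (J < m)%N by rewrite ltnNge; apply: contra nMm => /smallJ.
have higha k : (m < k)%N -> M a`_k.
  by move=> ltmk; apply/negPn/negP => /maxm; rewrite leqNgt ltmk.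
have h : M ((a * b)`_(m + m) - a`_m * b`_m).
  by apply: coefM_high => // k ltk; rewrite hab ?higha // (ltn_trans ltJm).
move/(M_eqmod hv): h; rewrite high ?addnn ?ltn_double // hab // => /esym /M_sqr.
exact/negP.
Qed.

(* The difference of two decompositions is [4 e (e + h)]; the lowest and the
   highest unit coefficients of the two factors cannot cancel. *)
Lemma clean_optimal (h g H : {poly K}) n J : PO v h ->
  ~~ M h`_n -> (forall i, (i < n)%N -> M h`_i) ->
  (size h <= J.+1)%N -> (size g <= J.*2.+1)%N ->
  (forall i, O (g`_i / 4%:R)) ->
  (forall j, (j <= J)%N -> M (g`_(j + minn j n) / 4%:R)) ->
  (forall i, M ((h * h + g - H * H)`_i / 4%:R)) ->
  forall i, M (g`_i / 4%:R).
Proof.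
move=> Oh nMhn lowh szh szg Og clean better.
have n2 := two_neq0 hv; have n4 := four_neq0.
have leJ i : ~~ M h`_i -> (i <= J)%N.
  rewrite leqNgt; apply: contra => ltJi.
  by rewrite nth_default ?(M_0 hv) // (leq_trans szh).
(* With H = h + 2 e the two remainders differ by H^2 - h^2 = 4 e (e + h). *)
pose e : {poly K} := 2%:R^-1 *: (H - h).
have Ee : e * (e + h) = 4%:R^-1 *: (g - (h * h + g - H * H)).
  have -> : e + h = 2%:R^-1 *: (H + h).
    have hh : h = 2%:R^-1 *: (2%:R *: h) by rewrite scalerA mulVf ?scale1r.
    by rewrite /e {2}hh -scalerDr scaler_nat; congr (_ *: _); ring.
  rewrite /e -!scalerAr -!scalerAl !scalerA.
  have -> : 2%:R^-1 * 2%:R^-1 = 4%:R^-1 :> K by rewrite -invfM -natrM.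
  by congr (_ *: _); ring.
have coefEe i : (e * (e + h))`_i = g`_i / 4%:R - (h * h + g - H * H)`_i / 4%:R.
  by rewrite Ee coefZ coefB mulrC mulrBl.
have Qeq i : M (e * (e + h))`_i = M (g`_i / 4%:R).
  by apply: (M_eqmod hv); rewrite coefEe addrAC subrr add0r (M_opp hv).
have Oe : PO v e.
  apply: (PO_sqr hv Oh) => i; rewrite [h * e]mulrC -mulrDr coefEe.
  by apply: O_sub => //; apply: MO.
have Oeh : PO v (e + h) by apply: PO_add.
(* Below n, [e] and [e + h] agree modulo the maximal ideal, so a first unit e_i with i < n would
   give a unit at 2 i = i + min(i, n). *)
have lowe i : (i < n)%N -> M e`_i.
  elim/ltn_ind: i => i IH ltin; apply/negPn/negP => nMe.
  have low k : (k < i)%N -> M e`_k by move=> ltk; rewrite IH // (ltn_trans ltk).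
  have low' k : (k < i)%N -> M (e + h)`_k.
    by move=> ltk; rewrite coefD (M_add hv) ?low // lowh // (ltn_trans ltk).
  have := coefM_low hv Oe Oeh low low'.
  have Mi : M (e * (e + h))`_(i + i).
    rewrite Qeq; have := clean i; rewrite (minn_idPl (ltnW ltin)); apply.
    exact: leq_trans (ltnW ltin) (leJ _ nMhn).
  move/(M_eqmod hv); rewrite Mi => /esym /(M_prime hv (Oe i) (Oeh i)).
  rewrite (negbTE nMe) coefD /= => Meh.
  by move: nMe; rewrite -[e`_i](addrK h`_i) (M_sub hv) // lowh.
have loweh i : (i < n)%N -> M (e + h)`_i.
  by move=> ltin; rewrite coefD (M_add hv) ?lowe ?lowh.
have Qclean i : (n < i <= J)%N -> M (e * (e + h))`_(i + n).
  by case/andP => ltni leiJ; rewrite Qeq; have := clean i leiJ; rewrite (minn_idPr (ltnW ltni)).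
have Qhigh i : (J.*2 < i)%N -> M (e * (e + h))`_i.
  move=> lti; rewrite Qeq nth_default ?mul0r ?(M_0 hv) //.
  exact: leq_trans szg lti.
have heq i : (J < i)%N -> (e + h)`_i = e`_i.
  by move=> lti; rewrite coefD [h`_i]nth_default ?addr0 // (leq_trans szh).
have Mn : M (e`_n * (e + h)`_n).
  rewrite -(M_eqmod hv (coefM_low hv Oe Oeh lowe loweh)) Qeq.
  by have := clean n (leJ _ nMhn); rewrite minnn.
suff Mall : PM v e \/ PM v (e + h).
  by move=> i; rewrite -Qeq; case: Mall => Mp; [|rewrite mulrC]; apply: PM_mul.
(* One factor is small at n, and the other is then a unit there since they differ by h_n; the two
   cases exchange [e] and [e + h]. *)
case/orP: (M_prime hv (Oe n) (Oeh n) Mn) => [Men|Mehn]; [left | right].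
- apply: (factor_small (b := e + h) (n := n) (J := J)) => //.
  + by move=> i; rewrite leq_eqVlt => /orP[/eqP->|/lowe].
  + by rewrite coefD; apply: contra nMhn => M1; rewrite -[h`_n](addKr e`_n) (M_add hv) ?M_opp.
- apply: (factor_small (b := e) (n := n) (J := J)) => //.
  + by move=> i; rewrite leq_eqVlt => /orP[/eqP->|/loweh].
  + apply: contra nMhn => M1; have -> : h`_n = (e + h)`_n - e`_n by rewrite coefD addrC addKr.
    by rewrite (M_sub hv).
  + by move=> i /heq.
  + by move=> i; rewrite mulrC; apply: Qclean.
  + by move=> i; rewrite mulrC; apply: Qhigh.
Qed.

End Optimality.
(** * Laurent polynomials as shifted polynomials *)

Section Laurent.
Variable K : fieldType.

(** The Laurent polynomial X^-N p. *)
Definition laurent_shift (N : nat) (p : {poly K}) : int -> K :=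
  fun i => laurent_of_poly p (i + N%:Z).

Lemma laurent_of_poly_lt0 (p : {poly K}) i : (i < 0)%R -> laurent_of_poly p i = 0.
Proof. by case: i. Qed.

Lemma laurent_of_polyD (p q : {poly K}) :
  laurent_of_poly (p + q) = laurent_add (laurent_of_poly p) (laurent_of_poly q).
Proof.
by apply/funext => -[n|n]; rewrite /laurent_add /= ?coefD ?addr0.
Qed.

Lemma laurent_of_polyM (p q : {poly K}) n :
  \sum_(i \in [set: int]) (laurent_of_poly p i * laurent_of_poly q (n - i)) =
  laurent_of_poly (p * q) n.
Proof.
case: n => n; last first.
  rewrite (fsbigE [::]) ?big_nil // => i _ _.
  by case: i => i /=; rewrite ?mul0r // laurent_of_poly_lt0 ?mulr0 //; lia.
rewrite (fsbigE [seq Posz k | k <- iota 0 n.+1]).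
- rewrite big_map [RHS]coefM -(big_mkord xpredT (fun k => p`_k * q`_(n - k))).
  rewrite /index_iota subn0 big_seq_cond [RHS]big_seq_cond; apply: eq_big => i.
    by rewrite in_setT.
  by rewrite mem_iota => /andP[/andP[_ lti] _]; rewrite subzn.
- by rewrite map_inj_uniq ?iota_uniq // => ? ? [].
- by [].
- move=> [i|i] _; last by rewrite mul0r.
  rewrite mem_map => [|? ? []//]; rewrite mem_iota add0n ltnS -ltnNge => lti.
  by rewrite [laurent_of_poly q _]laurent_of_poly_lt0 ?mulr0 //; lia.
Qed.

Lemma laurent_shiftM M N (p q : {poly K}) :
  laurent_mul (laurent_shift M p) (laurent_shift N q) = laurent_shift (M + N) (p * q).
Proof.
apply/funext => n; rewrite /laurent_mul /laurent_shift -laurent_of_polyM.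
rewrite [LHS](reindex_fsbigT (fun i : int => i - M%:Z)).
  by apply: eq_fsbigr => i _; congr (laurent_of_poly _ _ * laurent_of_poly _ _); lia.
by exists (fun i : int => i + M%:Z) => i; lia.
Qed.

Lemma laurent_of_poly_mul (p q : {poly K}) :
  laurent_mul (laurent_of_poly p) (laurent_of_poly q) = laurent_of_poly (p * q).
Proof. by apply/funext => n; rewrite -laurent_of_polyM. Qed.

Lemma laurent_shift_of_poly N (p : {poly K}) :
  laurent_of_poly p = laurent_shift N ('X^N * p).
Proof.
apply/funext => -[n|n]; rewrite /laurent_shift.
  by rewrite -PoszD /= coefXnM ltnNge leq_addl addnK.
have [lt0|ge0] := ltrP (Negz n + N%:Z) 0; first by rewrite [RHS]laurent_of_poly_lt0.
have -> : Negz n + N%:Z = Posz (N - n.+1) by lia.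
by rewrite /= coefXnM ifT //; lia.
Qed.

Lemma finite_support_shift (a : int -> K) : finite_set [set i | a i != 0] ->
  exists (N : nat) (p : {poly K}), a = laurent_shift N p.
Proof.
case/finite_seqP => s Es; pose N := \max_(i <- s) `|i|%N.
have supp i : a i != 0 -> (`|i| <= N)%N.
  move=> nz; have : [set i | a i != 0] i by [].
  by rewrite Es /= => si; apply: (@leq_bigmax_seq _ s xpredT (fun i => `|i|%N)).
exists N, (\poly_(k < N.*2.+1) a (k%:Z - N%:Z)); apply/funext => i.
rewrite /laurent_shift; have [/eqP ai0|nz] := boolP (a i == 0).
  case Ei: (i + N%:Z) => [k|k] //=; rewrite coef_poly; case: ifP => // _.
  by rewrite -Ei addrK ai0.
have le_iN := supp _ nz.
have -> : i + N%:Z = Posz (absz (i + N%:Z)) by lia.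
rewrite /= coef_poly ifT; last by lia.
by congr a; lia.
Qed.

Lemma laurent_of_poly_finite (p : {poly K}) :
  finite_set [set i | laurent_of_poly p i != 0].
Proof.
apply: (sub_finite_set (B := [set` [seq Posz k | k <- iota 0 (size p)]])).
  move=> [i|i] /=; rewrite ?eqxx // => nz; apply: map_f; rewrite mem_iota /=.
  by rewrite ltnNge; apply: contra nz => le; rewrite nth_default.
exact: finite_seq.
Qed.
End Laurent.

(** * Optimality among Laurent polynomials *)

Section LaurentOptimality.
Variables (K : fieldType) (RR : realType) (v : K -> \bar RR) (S : set K).
Hypothesis hv : dyadic_valuation v.
Hypothesis hS : forall x, vring v x <-> S x.

Local Notation O := (vring v).
Local Notation M := (vmax v).

Lemma laurent_of_poly_in (p : {poly K}) : PO v p -> laurent S (laurent_of_poly p).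
Proof.
move=> Op; split; first exact: laurent_of_poly_finite.
by move=> [n|n] /=; apply/hS; [apply: Op | apply: O_0].
Qed.

Lemma laurent_val_min (g : {poly K}) k : g`_k != 0 ->
  (forall i, O (g`_i / g`_k)) -> laurent_val v (laurent_of_poly g) = v g`_k.
Proof.
move=> gk0 gmin; apply/eqP; rewrite eq_le; apply/andP; split.
  by apply: ereal_inf_lbound; exists (Posz k).
apply: le_ereal_inf_tmp => _ [[n|n] _ <-] /=; first by rewrite v_leE.
by rewrite (dv_0 hv) leey.
Qed.

Lemma v_4 : v 4%:R = 2%:R%:E.
Proof. by rewrite (natrM _ 2 2) (dv_M hv) (dv_2 hv). Qed.

Lemma optimal_of_small (f h g : {poly K}) : f = h * h + g -> PO v h ->
  (forall i, M (g`_i / 4%:R)) ->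
  optimal_decomposition S v
    (laurent_of_poly f) (laurent_of_poly h) (laurent_of_poly g).
Proof.
move=> -> Oh Mg.
have Og : PO v g.
  move=> i; rewrite -[g`_i](divfK (four_neq0 hv)) MO // M_mull // O_nat //.
split; rewrite ?laurent_of_polyD ?laurent_of_poly_mul //; do ?exact: laurent_of_poly_in.
right; have [->|g0] := eqVneq g 0.
  rewrite (_ : laurent_val _ _ = +oo)%E ?ltey //; apply/eqP; rewrite -leye_eq.
  by apply: le_ereal_inf_tmp => _ [[n|n] _ <-]; rewrite /= ?coef0 (dv_0 hv).
have [k [gk0 gmin]] := min_coef hv g0.
by rewrite (laurent_val_min gk0 gmin) -v_4 (v_ltE hv) // (four_neq0 hv).
Qed.

(** The valuation of g is attained at k, so only a strictly better competitor X^-N H has to be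
    excluded; multiplication by X^(2N) makes its remainder a polynomial. *)
Lemma optimal_of_min (f h g : {poly K}) k : f = h * h + g -> PO v h -> PO v g ->
  g`_k != 0 -> (forall i, O (g`_i / g`_k)) ->
  (forall N (H : {poly K}),
    ~ (forall i, M (('X^N * h * ('X^N * h) + 'X^(N + N) * g - H * H)`_i / g`_k))) ->
  optimal_decomposition S v
    (laurent_of_poly f) (laurent_of_poly h) (laurent_of_poly g).
Proof.
move=> Ef Oh Og gk0 gmin best.
split; rewrite ?Ef ?laurent_of_polyD ?laurent_of_poly_mul //;
  do ?exact: laurent_of_poly_in.
rewrite -laurent_of_polyD -Ef (laurent_val_min gk0 gmin); left.
apply/eqP; rewrite eq_le; apply/andP; split.
  apply: ereal_sup_ubound; exists (laurent_of_poly h); first exact: laurent_of_poly_in.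
  rewrite -(laurent_val_min gk0 gmin) laurent_of_poly_mul; congr laurent_val.
  by apply/funext => i; rewrite Ef laurent_of_polyD /laurent_sub /laurent_add addrAC subrr add0r.
apply: ge_ereal_sup => _ [a [/finite_support_shift[N [H ->]] _] <-].
rewrite leNgt; apply/negP => lt; apply: (best N H) => i.
rewrite -(v_ltE hv _ gk0); apply: lt_le_trans lt _.
apply: ereal_inf_lbound; exists (i%:Z - (N + N)%:Z) => //.
rewrite /laurent_sub laurent_shiftM (laurent_shift_of_poly (N + N)) /laurent_shift.
rewrite subrK /= -coefB; congr (v (coefp i _)); rewrite Ef exprD; ring.
Qed.

(** Multiplication by X^(2N) moves the dominant position k to k + 2N, which is odd again. *)
Lemma odd_decomposition_optimal (f h g : {poly K}) k (a : K) :
  f = h * h + g -> PO v h -> PO v g -> odd k -> a * a = g`_k -> g`_k != 0 ->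
  M (4%:R / g`_k) -> (forall i, O (g`_i / g`_k)) ->
  optimal_decomposition S v
    (laurent_of_poly f) (laurent_of_poly h) (laurent_of_poly g).
Proof.
move=> Ef Oh Og oddk aa gk0 M4 gmin.
apply: (optimal_of_min Ef Oh Og gk0 gmin) => N H better.
have coefXg i : ('X^(N + N) * g)`_i = if (i < N + N)%N then 0 else g`_(i - (N + N)).
  by rewrite coefXnM.
have Xk : ('X^(N + N) * g)`_(k + (N + N)) = g`_k by rewrite coefXg ltnNge leq_addl addnK.
apply: (@odd_optimal _ _ _ hv ('X^N * h) ('X^(N + N) * g) H (k + (N + N)) a); rewrite ?Xk //.
- by apply: PO_mul => //; apply: PO_X.
- by rewrite oddD addnn odd_double addbF.
- by move=> i; rewrite coefXg; case: ifP; rewrite // mul0r O_0.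
Qed.

(** Either v(g) > 2, or a minimal g_k has v(g_k) <= 2 and a better competitor would make g_k / 4
    small by [clean_optimal]. Multiplying h by X^N moves n and J by N and the cleared positions by
    2N. *)
Lemma clean_decomposition_optimal (f h g : {poly K}) n J :
  f = h * h + g -> PO v h ->
  ~~ M h`_n -> (forall i, (i < n)%N -> M h`_i) ->
  (size h <= J.+1)%N -> (size g <= J.*2.+1)%N ->
  (forall i, O (g`_i / 4%:R)) ->
  (forall j, (j <= J)%N -> M (g`_(j + minn j n) / 4%:R)) ->
  optimal_decomposition S v
    (laurent_of_poly f) (laurent_of_poly h) (laurent_of_poly g).
Proof.
move=> Ef Oh nMhn lowh szh szg Og clean; have n4 := four_neq0 hv.
have [/(optimal_of_small Ef Oh)//|/existsNP[i /negP nMgi]] :=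
  pselect (forall i, M (g`_i / 4%:R)).
have g0 : g != 0 by apply: contraNneq nMgi => ->; rewrite coef0 mul0r M_0.
have [k [gk0 gmin]] := min_coef hv g0.
have nMgk : ~~ M (g`_k / 4%:R).
  apply: contra nMgi => Mk; have -> : g`_i / 4%:R = (g`_i / g`_k) * (g`_k / 4%:R).
    by rewrite mulrA divfK.
  exact: M_mulr.
have POg : PO v g.
  by move=> j; rewrite -[g`_j](divfK n4) O_mul // O_nat.
apply: (optimal_of_min Ef Oh POg gk0 gmin) => N H better.
have coefXn m (p : {poly K}) j : ('X^m * p)`_j = if (j < m)%N then 0 else p`_(j - m).
  by rewrite coefXnM.
suff : M (('X^(N + N) * g)`_(k + (N + N)) / 4%:R).
  by rewrite coefXn ltnNge leq_addl addnK /= (negbTE nMgk).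
apply: (@clean_optimal _ _ _ hv ('X^N * h) ('X^(N + N) * g) H (n + N) (J + N)).
- by apply: PO_mul => //; apply: PO_X.
- by rewrite coefXn ltnNge leq_addl addnK.
- move=> j ltj; rewrite coefXn; case: ltnP => [_|leN]; first exact: M_0.
  by apply: lowh; lia.
- apply: leq_trans (size_polyMleq _ _) _; rewrite size_polyXn; lia.
- apply: leq_trans (size_polyMleq _ _) _; rewrite size_polyXn; lia.
- move=> j; rewrite coefXn; case: ltnP => // _; by rewrite mul0r O_0.
- move=> j lej; rewrite coefXn; case: ltnP => [_|leN]; first by rewrite mul0r M_0.
  have -> : (j + minn j (n + N) - (N + N) = (j - N) + minn (j - N) n)%N by lia.
  by apply: clean; lia.
- move=> j; have -> : forall x : K, x / 4%:R = (x / g`_k) * (g`_k / 4%:R).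
    by move=> x; rewrite mulrA divfK.
  exact: M_mull.
Qed.
End LaurentOptimality.
(** * The two improvement steps *)

Section Refinement.
Variables (K : fieldType) (RR : realType) (v : K -> \bar RR).
Hypothesis hv : dyadic_valuation v.

Local Notation O := (vring v).
Local Notation M := (vmax v).

Lemma refine_coef (f h : {poly K}) c j i :
  (f - (h + (2%:R * c) *: 'X^j) * (h + (2%:R * c) *: 'X^j))`_i / 4%:R =
  (f - h * h)`_i / 4%:R - c * (if (i < j)%N then 0 else h`_(i - j))
    - (if i == j.*2 then c * c else 0).
Proof.
have n4 := four_neq0 hv.
have -> : f - (h + (2%:R * c) *: 'X^j) * (h + (2%:R * c) *: 'X^j) =
    (f - h * h) - (4%:R * c) *: ('X^j * h) - (4%:R * (c * c)) *: 'X^(j.*2).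
  rewrite -!mul_polyC !polyCM !polyC_natr -addnn exprD; ring.
rewrite !coefB !coefZ coefXnM coefXn.
by case: (i < j)%N; case: (i == j.*2) => /=; field; apply: n4.
Qed.

(** For i < j the position i + min(i, n) is below j + n, so the correction there involves only
    coefficients of h below n, and c^2 enters at 2 j, beyond it. *)
Lemma refine_clean (f h : {poly K}) c j n : O c -> (n <= j)%N ->
  (forall i, (i < n)%N -> M h`_i) ->
  (forall i, (i < j)%N -> M ((f - h * h)`_(i + minn i n) / 4%:R)) ->
  M ((f - h * h)`_(j + n) / 4%:R - c * h`_n - (if n == j then c * c else 0)) ->
  let h' := h + (2%:R * c) *: 'X^j in
  forall i, (i < j.+1)%N -> M ((f - h' * h')`_(i + minn i n) / 4%:R).
Proof.
move=> Oc lenj lowh clean cleanj h' i; rewrite ltnS leq_eqVlt refine_coef.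
case/orP => [/eqP->|ltij].
  rewrite (minn_idPr lenj) ltnNge leq_addr addKn -addnn eqn_add2l /=.
  exact: cleanj.
have lt2 : (i + minn i n < j + n)%N by lia.
rewrite (_ : (i + minn i n == j.*2) = false); last by lia.
rewrite subr0 (M_sub hv) ?clean //; apply: M_mulr => //.
by case: ltnP => [_|lej]; [apply: M_0 | apply: lowh; lia].
Qed.

Lemma refine_integral (f h : {poly K}) c j : O c -> PO v h ->
  (forall i, O ((f - h * h)`_i / 4%:R)) ->
  let h' := h + (2%:R * c) *: 'X^j in
  forall i, O ((f - h' * h')`_i / 4%:R).
Proof.
move=> Oc Oh Og h' i; rewrite refine_coef; apply: O_sub => //.
  apply: O_sub => //; apply: O_mul => //.
  by case: ifP => _ //; apply: O_0.
by case: ifP => _; [apply: O_mul | apply: O_0].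
Qed.

(* Adding a multiple of 2 to [h] changes [f - h * h] by a multiple of 4, which
   is negligible against a coefficient of valuation less than 2. *)
Lemma odd_after_refinement (S : set K) (f h e : {poly K}) :
  (forall x, O x <-> S x) -> PO v f -> PO v h -> PO v e ->
  (forall i, (f - h * h)`_(i.*2) = 0) ->
  (exists i, ~~ O ((f - h * h)`_i / 4%:R)) ->
  (forall x : K, exists a, a * a = x) ->
  let h' := h + 2%:R *: e in
  optimal_decomposition S v (laurent_of_poly f) (laurent_of_poly h')
    (laurent_of_poly (f - h' * h')).
Proof.
move=> hS Of Oh Oe even [i0 nO] sqrt h'; set g := f - h * h in even nO.
have n4 := four_neq0 hv.
have g0 : g != 0 by apply: contraNneq nO => ->; rewrite coef0 mul0r O_0.
have [m [gm0 gmin]] := min_coef hv g0.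
have nOm : ~~ O (g`_m / 4%:R).
  apply: contra nO => Om; have -> : g`_i0 / 4%:R = (g`_i0 / g`_m) * (g`_m / 4%:R).
    by rewrite mulrA divfK.
  exact: O_mul.
have M4 : M (4%:R / g`_m) by have := M_inv hv nOm; rewrite invf_div.
have oddm : odd m.
  by apply: contraNT gm0 => /even_halfK <-; rewrite even.
pose s := e * e + h * e.
have Os : PO v s by apply: PO_add => //; apply: PO_mul.
have Eg' i : (f - h' * h')`_i = g`_i - 4%:R * s`_i.
  have -> : f - h' * h' = g - 4%:R *: s.
    rewrite /h' /g /s -!mul_polyC !polyC_natr; ring.
  by rewrite coefB coefZ.
set g' := f - h' * h' in Eg' *.
(* Since v(g_m) < v(4), the change 4 s_m is negligible and m stays the dominant position. *)
have unit : M (g'`_m / g`_m - 1).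
  rewrite Eg' mulrBl divff // addrAC subrr add0r M_opp // mulrAC.
  exact: M_mull.
have nMu : ~~ M (g'`_m / g`_m) by rewrite (M_eqmod hv unit) M_1.
have g'm0 : g'`_m != 0.
  by apply: contraNneq nMu => ->; rewrite mul0r M_0.
have Oinv : O (g`_m / g'`_m) by have := O_inv hv nMu; rewrite invf_div.
have Oh' : PO v h' by apply: PO_add => //; apply: PO_scale => //; apply: O_nat.
have [b Eb] := sqrt g'`_m.
apply: (odd_decomposition_optimal hv hS (k := m) (a := b)) => //.
- by rewrite addrC subrK.
- by apply: PO_sub => //; apply: PO_mul.
- have -> : 4%:R / g'`_m = (4%:R / g`_m) * (g`_m / g'`_m) by rewrite mulrA divfK.
  exact: M_mull.
- move=> i; have -> : g'`_i / g'`_m = (g'`_i / g`_m) * (g`_m / g'`_m).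
    by rewrite mulrA divfK.
  apply: O_mul => //; rewrite Eg' mulrBl; apply: O_sub => //.
  by rewrite mulrAC; apply: O_mul => //; apply: MO.
Qed.

(** [PO_sqr] looks only at even positions, where h^2 has the coefficients of f. *)
Lemma PO_sqrt_even (h f : {poly K}) : PO v f ->
  (forall i, (f - h * h)`_(i.*2) = 0) -> PO v h.
Proof.
move=> Of even; apply: (PO_sqr hv (b := 0)) => [i|i]; first by rewrite coef0 O_0.
rewrite mul0r addr0; have /eqP := even i.
by rewrite coefB subr_eq0 => /eqP <-.
Qed.

End Refinement.

(** * Adjoining the roots of the even part *)

Section EvenNorm.
Variable K : fieldType.

(* [u * u + w * w] with [w = u \Po - 'X] is twice the even part of [u * u].
   It is multiplicative in the sense used to adjoin one root at a time. *)
Definition even_norm (u w : {poly K}) : Prop := w = u \Po (- 'X) /\ u = w \Po (- 'X).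

(** This is the identity (s^2 + X^2)(u^2 + w^2) = (s u + X w)^2 + (s w - X u)^2; replacing X by - X
    exchanges the two new polynomials. *)
Lemma even_norm_step (u w : {poly K}) (s r : K) : s * s = - r -> even_norm u w ->
  even_norm (s *: u + 'X * w) (s *: w - 'X * u) /\
  (s *: u + 'X * w) * (s *: u + 'X * w) + (s *: w - 'X * u) * (s *: w - 'X * u) =
  ('X^2 - r%:P) * (u * u + w * w).
Proof.
move=> Es [Ew Eu]; split.
  by split; rewrite ?comp_polyB ?comp_polyD comp_polyZ comp_polyM comp_polyX -?Ew -?Eu; ring.
have -> : r%:P = - (s%:P * s%:P) by rewrite -polyCM Es polyCN opprK.
by rewrite -!mul_polyC; ring.
Qed.

Lemma coef_comp_opp (p : {poly K}) i : (p \Po (- 'X))`_i.*2 = p`_i.*2.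
Proof.
have -> : - 'X = (-1)%:P * 'X :> {poly K} by rewrite mul_polyC scaleN1r.
suff coefE k : (p \Po ((-1)%:P * 'X))`_k = (-1) ^+ k * p`_k.
  by rewrite coefE -signr_odd odd_double mul1r.
elim/poly_ind: p k => [|p c IH] k; first by rewrite comp_poly0 coef0 mulr0.
rewrite comp_polyD comp_polyM comp_polyX comp_polyC mulrCA coefD coefCM.
rewrite !coefD !coefMX !coefC; case: k => [|k] /=; first by ring.
by rewrite IH exprS; ring.
Qed.

Lemma even_norm_coef (u w : {poly K}) i : even_norm u w ->
  (u * u + w * w)`_i.*2 = 2%:R * (u * u)`_i.*2.
Proof.
by case=> -> _; rewrite -comp_polyM coefD coef_comp_opp; ring.
Qed.

End EvenNorm.
(** * The program *)

Definition EZero : expr := EAdd EOne (EOpp EOne).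
Definition ETwo : expr := EAdd EOne EOne.
Definition EFour : expr := EMul ETwo ETwo.
Definition ESqrt (e : expr) : expr :=
  ERoot (ECons (EOpp e) (ECons EZero (ECons EOne ENil))).

(** Two values are bound outside, so in the body values 2, 3 and 4 are the remaining list, the
    partial result and the item. *)
Definition t_catrev : term :=
  TFold (EVar 0) (EVar 1) (TExpr (ECons (EVar 4) (EVar 3))).

(** The state pairs the unread part of value 2 with the reversed result. An exhausted value 2 counts
    as zeros, and an unread rest is appended at the end. *)
Definition t_axpy : term :=
  TLet
    (TFold (EVar 1) (ECons (EVar 2) ENil)
      (TIf (EHead (EVar 4))
        (TExpr (ECons (ETail (EHead (EVar 4)))
          (ECons (EAdd (EMul (EVar 0) (EVar 5)) (EHead (EHead (EVar 4))))
            (ETail (EVar 4)))))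
        (TExpr (ECons ENil
          (ECons (EMul (EVar 0) (EVar 5)) (ETail (EVar 4)))))))
    (TCall t_catrev [:: ETail (EVar 3); EHead (EVar 3)]).

(** Horner's scheme, from the top coefficient of value 0 downwards. *)
Definition t_mul : term :=
  TLet (TCall t_catrev [:: EVar 0; ENil])
    (TFold (EVar 2) ENil
      (TCall t_axpy [:: EVar 5; EVar 1; ECons EZero (EVar 4)])).

(** Lists serve as unary numbers: only the length of value 0 matters. *)
Definition t_drop : term :=
  TFold (EVar 0) (EVar 1) (TExpr (ETail (EVar 3))).

(* Synthetic division of the list 1 by 'X - (value 0): the head of the result
   is the remainder, its tail is the quotient. *)
Definition t_div : term :=
  TLet (TCall t_catrev [:: EVar 1; ENil])
    (TFold (EVar 2) (ECons EZero ENil)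
      (TExpr (ECons (EAdd (EVar 5) (EMul (EVar 0) (EHead (EVar 4))))
        (EVar 4)))).

(** Prefixing a coefficient exchanges the even and the odd part, apart from the new constant term;
    the state holds both. *)
Definition t_even : term :=
  TLet (TCall t_catrev [:: EVar 0; ENil])
    (TLet
      (TFold (EVar 1) (ECons ENil ENil)
        (TExpr (ECons (ECons (EVar 4) (ETail (EVar 3))) (EHead (EVar 3)))))
      (TExpr (EHead (EVar 2)))).

Section ListPrograms.
Variables (K : fieldType) (vle : rel K) (rt : {poly K} -> K).
Local Notation D := (@data_of_seq K).
Local Notation ev := (tev vle rt).

Lemma dfold_seq (A : Type) (R : A -> data K) F (step : A -> K -> A) :
  (forall r a x, F r (R a) (DAtom x) = R (step a x)) ->
  forall s a, dfold F (R a) (D s) = R (foldl step a s).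
Proof. by move=> FR; elim=> //= x s IH a; rewrite FR IH. Qed.

Lemma dfold_ind (P : nat -> data K -> Prop) F a s : P 0%N a ->
  (forall i r d x, (i < size s)%N -> P i d -> P i.+1 (F r d (DAtom x))) ->
  P (size s) (dfold F a (D s)).
Proof.
elim: s P a => //= x s IH P a P0 PS; apply: (IH (fun i => P i.+1)).
  exact: PS.
by move=> i r d y lti; apply: PS.
Qed.

Lemma seq_of_dataK s : seq_of_data (D s) = s.
Proof. by elim: s => //= x s ->. Qed.

Lemma t_catrevP l a : ev [:: D l; D a] t_catrev = D (catrev l a).
Proof.
rewrite /t_catrev /= (dfold_seq (step := fun s x => x :: s)) //.
by elim: l a => //= x l IH a; rewrite IH.
Qed.
#[global] Opaque t_catrev.

Lemma t_dropP l1 l2 : ev [:: D l1; D l2] t_drop = D (drop (size l1) l2).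
Proof.
rewrite /t_drop /= (dfold_seq (step := fun s _ => behead s)); last by move=> _ [].
by elim: l1 l2 => [|x l1 IH] l2 /=; rewrite ?drop0 // IH; case: l2.
Qed.
#[global] Opaque t_drop.

Fixpoint axpy (c : K) (p q : seq K) : seq K :=
  match p, q with
  | x :: p', y :: q' => (c * x + y) :: axpy c p' q'
  | x :: p', [::] => c * x :: axpy c p' [::]
  | [::], _ => q
  end.

Lemma t_axpyP c p q : ev [:: DAtom c; D p; D q] t_axpy = D (axpy c p q).
Proof.
rewrite /t_axpy [LHS]/=; set F := fun r y x : data K => _.
suff [q' [r' [-> ->]]] : exists q' r',
    dfold F (DCons (D q) DNil) (D p) = DCons (D q') (D r') /\
    axpy c p q = catrev r' q' by rewrite /= t_catrevP.
rewrite -[axpy c p q]/(catrev [::] _) -[@DNil K]/(D [::]).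
elim: p q [::] => [|x p IH] q r; first by exists q, r.
by case: q => [|y q]; [have := IH [::] (c * x :: r) | have := IH q (c * x + y :: r)].
Qed.
#[global] Opaque t_axpy.

Lemma Poly_axpy c p q : Poly (axpy c p q) = c *: Poly p + Poly q.
Proof.
elim: p q => [|x p IH] q /=; first by rewrite scaler0 add0r.
case: q => [|y q] /=; rewrite !cons_poly_def IH -!mul_polyC ?polyCD !polyCM /=;
  ring.
Qed.

Lemma t_mulP p q : exists s, ev [:: D p; D q] t_mul = D s /\ Poly s = Poly p * Poly q.
Proof.
rewrite /t_mul [ev _ _]/= -[@DNil K]/(D [::]) t_catrevP.
rewrite (dfold_seq (step := fun a x => axpy x q (0 :: a))); last first.
  by move=> r a x /=; rewrite subrr -[DCons _ _]/(D (0 :: a)) t_axpyP.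
eexists; split=> //; rewrite -/(rev p) foldl_rev.
elim: p => [|x p IH] /=; first by rewrite mul0r.
by rewrite Poly_axpy /= !cons_poly_def IH -mul_polyC; ring.
Qed.
#[global] Opaque t_mul.

Lemma t_divP r q : exists m u, [/\ ev [:: DAtom r; D q] t_div = D (m :: u),
  Poly q = ('X - r%:P) * Poly u + m%:P & size u = size q].
Proof.
rewrite /t_div [ev _ _]/= -[@DNil K]/(D [::]) t_catrevP subrr.
pose R (a : K * seq K) := D (a.1 :: a.2).
rewrite (@dfold_seq _ R _ (fun a x => (x + r * a.1, a.1 :: a.2)) _ (rev q) (0, [::])) //.
rewrite foldl_rev; set a := foldr _ _ _.
exists a.1, a.2; split=> //; rewrite /a; elim: q {a} => [|x q IH] /=.
- by rewrite mulr0 add0r polyC0.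
- rewrite !cons_poly_def [Poly q]IH polyCD polyCM; ring.
- by [].
- by congr S.
Qed.
#[global] Opaque t_div.

Lemma t_evenP s : exists l, [/\ ev [:: D s] t_even = D l,
  Poly l = even_poly (Poly s), (size l <= size s)%N & (s != [::] -> l != [::])].
Proof.
rewrite /t_even [ev _ _]/= -[@DNil K]/(D [::]) t_catrevP.
pose R (a : seq K * seq K) := DCons (D a.1) (D a.2).
rewrite (@dfold_seq _ R _ (fun a x => (x :: a.2, a.1)) _ (rev s) ([::], [::])) //.
rewrite foldl_rev /=; set a := foldr _ _ _.
exists a.1.
have [Ea Oa] : Poly a.1 = even_poly (Poly s) /\ Poly a.2 = odd_poly (Poly s).
  rewrite /a; elim: s {a} => [|x s [IH1 IH2]] /=; first by rewrite even_polyC odd_polyC.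
  rewrite !cons_poly_def even_polyD odd_polyD even_polyMX odd_polyMX.
  by rewrite even_polyC odd_polyC addr0 IH1 IH2.
have [s1 s2] : (size a.1 <= size s)%N /\ (size a.2 <= size s)%N.
  by rewrite /a; elim: s {a Ea Oa} => [|x s [IH1 IH2]] //=; rewrite ltnS (leqW IH1).
by split=> //; rewrite /a; case: (s).
Qed.
#[global] Opaque t_even.

End ListPrograms.

(** * Programs for the two steps *)

Definition t_nth : term :=
  TLet (TCall t_drop [:: EVar 0; EVar 1])
    (TIf (EVar 2) (TExpr (EHead (EVar 2))) (TExpr EZero)).

(* The state is [(q, (u, w))] with
   [2 E('X^2) = q('X^2) (u * u + w * w)], where E is the even part of the
   input; a root of q is moved into u and w. *)
Definition t_odd_step : term :=
  let q := EHead (EVar 0) in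
  let u := EHead (ETail (EVar 0)) in
  let w := ETail (ETail (EVar 0)) in
  TLet (TExpr (ERoot q))
  (TLet (TCall t_div [:: EVar 1; q])
  (TIf (EValLe EZero (EHead (EVar 2)))
    (TLet (TExpr (ESqrt (EOpp (EVar 1))))
    (TLet (TCall t_axpy [:: EVar 3; u; ECons EZero w])
    (TLet (TCall t_axpy [:: EOpp EOne; ECons EZero u; ENil])
    (TLet (TCall t_axpy [:: EVar 3; w; EVar 5])
    (TExpr (ECons (ETail (EVar 2)) (ECons (EVar 4) (EVar 6))))))))
    (TExpr (EVar 0)))).

(** The tail of f only counts the passes, which reduce q to a constant c. The start u = w = 1
    accounts for the factor 2, and the result is u times a square root of c. *)
Definition t_odd : term :=
  let one := ECons EOne ENil in
  TLet (TCall t_even [:: EVar 0])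
  (TLet (TFold (ETail (EVar 0)) (ECons (EVar 1) (ECons one one))
          (TCall t_odd_step [:: EVar 3]))
  (TCall t_axpy [:: ESqrt (EHead (EHead (EVar 2)));
                    EHead (ETail (EVar 2)); ENil])).

(* Value 0 is f.  The state, value 1, is [(h, (z, m))]: z is a list of j zeros,
   and m is empty until the first unit coefficient h_n of h has been met, when
   it becomes the pair of a list of n zeros and that coefficient. *)
Definition t_refine_step : term :=
  let h := EHead (EVar 1) in
  let z := EHead (ETail (EVar 1)) in
  let m := ETail (ETail (EVar 1)) in
  TLet (TCall t_mul [:: h; h])
  (TLet (TCall t_axpy [:: EOpp EOne; EVar 2; EVar 0])
  (TLet (TCall t_drop [:: z; EVar 3])
  (TLet (TCall t_nth [:: z; h])
  (TLet
    (TIf m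
      (TLet (TCall t_nth [:: EHead m; EVar 4])
        (TExpr (ERoot (ECons (EOpp (EVar 6))
          (ECons (EMul EFour (ETail m)) ENil)))))
      (TLet (TCall t_nth [:: z; EVar 4])
        (TExpr (ERoot (ECons (EOpp (EVar 6))
          (ECons (EMul EFour (EVar 5)) (ECons EFour ENil)))))))
  (TLet
    (TIf (EValLe EOne (EVar 6))
      (TLet (TCall t_catrev [:: z; ECons (EMul ETwo (EVar 6)) ENil])
        (TCall t_axpy [:: EOne; EVar 7; h]))
      (TExpr h))
  (TLet
    (TIf m (TExpr m)
      (TIf (EValLe (EVar 5) EOne) (TExpr (ECons z (EVar 5))) (TExpr ENil)))
  (TExpr (ECons (EVar 7) (ECons (ECons EZero z) (EVar 8)))))))))).

Definition t_refine : term :=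
  TLet (TFold (EVar 0) (ECons (EVar 1) (ECons ENil ENil))
         (TCall t_refine_step [:: EVar 0; EVar 3]))
    (TExpr (EHead (EVar 2))).

Definition t_optimal : term :=
  TLet (TCall t_odd [:: EVar 0])
  (TLet (TCall t_refine [:: EVar 0; EVar 1])
  (TLet (TCall t_mul [:: EVar 2; EVar 2])
  (TLet (TCall t_axpy [:: EOpp EOne; EVar 3; EVar 0])
  (TExpr (ECons (EVar 2) (EVar 4)))))).

Section Roots.
Variables (K : fieldType) (rt : {poly K} -> K).
Hypothesis hrt : root_extraction rt.

Lemma root_Poly (s : seq K) : (1 < size s)%N -> last 0 s != 0 ->
  (Poly s).[rt (Poly s)] = 0.
Proof.
by move=> szs lasts; apply/rootP/hrt; rewrite (PolyK lasts).
Qed.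

Lemma rt_linear (a b : K) : b != 0 ->
  b * rt (Poly [:: - a; b]) = a.
Proof.
move=> b0; have := root_Poly (s := [:: - a; b]) isT b0.
move: (rt _) => x; rewrite horner_Poly /= mul0r add0r => /eqP.
by rewrite subr_eq0 mulrC; apply: eqP.
Qed.

Lemma rt_quadratic (a b c : K) : let x := rt (Poly [:: - a; b; c]) in
  c != 0 -> c * (x * x) + b * x = a.
Proof.
move=> x c0; have := root_Poly (s := [:: - a; b; c]) isT c0.
rewrite -/x horner_Poly /= mul0r add0r => /eqP.
by rewrite subr_eq0 => /eqP <-; ring.
Qed.

Lemma rt_sqrt (a : K) :
  rt (Poly [:: - a; 0; 1]) * rt (Poly [:: - a; 0; 1]) = a.
Proof.
by have := @rt_quadratic a 0 1 (oner_neq0 K); rewrite mul1r mul0r addr0.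
Qed.

End Roots.

(** * Correctness of the first step *)

Section DecompositionPrograms.
Variables (K : fieldType) (RR : realType) (v : K -> \bar RR).
Hypothesis hv : dyadic_valuation v.
Variable rt : {poly K} -> K.
Hypothesis hrt : root_extraction rt.

Local Notation O := (vring v).
Local Notation M := (vmax v).
Local Notation D := (@data_of_seq K).
Local Notation vle := (fun x y => (v x <= v y)%E).
Local Notation ev := (tev vle rt).

Lemma t_nthP (z s : seq K) : ev [:: D z; D s] t_nth = DAtom s`_(size z).
Proof.
rewrite /t_nth [ev _ _]/= t_dropP -[in RHS](addn0 (size z)) -nth_drop.
by case: (drop _ s) => //=; rewrite subrr.
Qed.
#[global] Opaque t_nth.

Lemma v_le0 x : (v 0 <= v x)%E = (x == 0).
Proof.
rewrite (dv_0 hv) leye_eq; have [->|/(dv_fin hv)[r ->]//] := eqVneq x 0.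
by rewrite (dv_0 hv) eqxx.
Qed.

(** The bound on q records that each pass lowers its degree until it is constant; those on u and w
    keep the resulting h within the size of f. *)
Definition odd_state (f : seq K) (i : nat) (d : data K) : Prop :=
  exists q u w : seq K,
  [/\ d = DCons (D q) (DCons (D u) (D w)),
      q != [::] /\ (size (Poly q) <= maxn 1 (size f - i))%N,
      (size (Poly u) <= i.+1)%N /\ (size (Poly w) <= i.+1)%N,
      even_norm (Poly u) (Poly w) &
      2%:R *: (even_poly (Poly f) \Po 'X^2) =
        (Poly q \Po 'X^2) * (Poly u * Poly u + Poly w * Poly w)].

Lemma t_odd_stepP f i d : odd_state f i d ->
  odd_state f i.+1 (ev [:: d] t_odd_step).
Proof.
move=> [q [u [w [-> [q0 szq] [szu szw] nuw Ef]]]].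
rewrite /t_odd_step [ev _ _]/= seq_of_dataK.
set r := rt (Poly q); have [m [q' [-> Eq szq']]] := t_divP vle rt r q.
(* Comparison with v 0 = +oo is the zero test. A nonzero remainder means that [r] is no root, so q
   is constant and the state may stay as it is. *)
rewrite /= subrr v_le0; case: eqP => [m0|/eqP m0] /=; last first.
  exists q, u, w; split=> //; [split=> // | by split; apply: leqW].
  have [szq1|szq1] := leqP (size (Poly q)) 1; first by rewrite leq_max szq1.
  case/eqP: m0; have /rootP := hrt szq1; rewrite -/r Eq.
  by rewrite hornerD hornerM hornerXsubC subrr mul0r add0r hornerC.
rewrite opprK; set s := rt _.
have Es : s * s = - r by rewrite -[RHS](rt_sqrt hrt) opprK.
rewrite -[DCons _ (D w)]/(D (0 :: w)) -[DCons _ (D u)]/(D (0 :: u)).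
rewrite -[@DNil K]/(D [::]) !t_axpyP.
rewrite m0 polyC0 addr0 in Eq.
have [n1 n2] := even_norm_step Es nuw.
have Eu : Poly (axpy s u (0 :: w)) = s *: Poly u + 'X * Poly w.
  by rewrite Poly_axpy /= cons_poly_def addr0 mulrC.
have Ew : Poly (axpy s w (axpy (-1) (0 :: u) [::])) = s *: Poly w - 'X * Poly u.
  by rewrite !Poly_axpy /= cons_poly_def addr0 addr0 scaleN1r mulrC.
exists q', (axpy s u (0 :: w)), (axpy s w (axpy (-1) (0 :: u) [::])).
rewrite Eu Ew; split=> //.
- split; first by rewrite -size_eq0 szq' size_eq0.
  have [->|q'0] := eqVneq (Poly q') 0; first by rewrite size_poly0.
  move: szq; rewrite Eq size_mul ?polyXsubC_eq0 // (size_XsubC r : _ = 2%N).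
  move: q'0; rewrite -size_poly_gt0; move: (size (Poly q')) (size f) => a b.
  lia.
- have szXM (p : {poly K}) : (size p <= i.+1)%N -> (size ('X * p)%R <= i.+2)%N.
    by move=> szp; apply: leq_trans (size_polyMleq _ _) _; rewrite size_polyX.
  split; apply: leq_trans (size_polyD _ _) _; rewrite geq_max ?size_polyN szXM // andbT.
  + exact: leq_trans (size_scale_leq _ _) (leqW szu).
  + exact: leq_trans (size_scale_leq _ _) (leqW szw).
- by rewrite n2 Ef Eq comp_polyM comp_polyB comp_polyX comp_polyC; ring.
Qed.
#[global] Opaque t_odd_step.

Lemma t_oddP f : f != [::] -> exists l : seq K,
  [/\ ev [:: D f] t_odd = D l, (size (Poly l) <= size f)%N &
      forall i, (Poly f - Poly l * Poly l)`_i.*2 = 0].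
Proof.
move=> f0; rewrite /t_odd [ev _ _]/=.
have [E [-> PE szE E0]] := t_evenP vle rt f.
have -> : (if D f is DCons _ x then x else DNil) = D (behead f) by case: (f).
set d := dfold _ _ _; have : odd_state f (size (behead f)) d.
  apply: (dfold_ind (P := odd_state f)) => [|i r d' x _]; last exact: t_odd_stepP.
  exists E, [:: 1], [:: 1]; rewrite /= cons_poly_def mul0r add0r PE.
  split=> //.
  - split; first exact: E0.
    by rewrite -PE subn0; apply: leq_trans (size_Poly _) (leq_trans szE (leq_maxr _ _)).
  - by rewrite size_poly1.
  - by split; rewrite comp_polyC.
  - by rewrite -mul_polyC polyC_natr mulr1; ring.
have szf : (0 < size f)%N by rewrite lt0n size_eq0.
case=> [[|c q] [u [w [-> [//_ szq] [szu _] nuw Ef]]]] /=; rewrite ?subrr.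
set s := rt _; have Es : s * s = c by apply: rt_sqrt.
rewrite -[@DNil K]/(D [::]) t_axpyP; exists (axpy s u [::]); split=> //.
  rewrite Poly_axpy addr0; apply: leq_trans (size_scale_leq _ _) _.
  by apply: leq_trans szu _; rewrite size_behead prednK.
move=> i; rewrite Poly_axpy addr0.
have Eq : Poly (c :: q) = c%:P.
  rewrite [LHS]size1_polyC; first by rewrite coef_Poly.
  by apply: leq_trans szq _; rewrite size_behead; move: (size f) => n; lia.
(* At position 2 i, u^2 + w^2 is twice u^2; cancelling 2 shows that f has there c times the
   coefficient of u^2. *)
move: Ef; rewrite Eq comp_polyC => /(congr1 (fun p : {poly K} => p`_i.*2)).
rewrite coefZ coefCM even_norm_coef // coef_comp_poly_Xn // dvdn2 odd_double.
rewrite divn2 doubleK coef_even_poly mulrCA => /(mulfI (two_neq0 hv)) Ef.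
by rewrite coefB -scalerAl -scalerAr !coefZ mulrA Es Ef subrr.
Qed.
#[global] Opaque t_odd.

End DecompositionPrograms.

(** * Correctness of the second step *)

Section RefinementProgram.
Variables (K : fieldType) (RR : realType) (v : K -> \bar RR).
Hypothesis hv : dyadic_valuation v.
Variable rt : {poly K} -> K.
Hypothesis hrt : root_extraction rt.
Variables (f h0 : seq K).
Hypothesis Oh0 : PO v (Poly h0).

Local Notation O := (vring v).
Local Notation M := (vmax v).
Local Notation D := (@data_of_seq K).
Local Notation vle := (fun x y => (v x <= v y)%E).
Local Notation ev := (tev vle rt).

Let integral4 (g : {poly K}) := forall i, O (g`_i / 4%:R).

(** Clearing is claimed only when (f - h0^2) / 4 is integral; otherwise the form h0 + 2 e suffices
    for [odd_after_refinement]. *)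
Definition refined (j n : nat) (h : {poly K}) : Prop :=
  [/\ exists2 e, PO v e & h = Poly h0 + 2%:R *: e,
      (size h <= size f)%N,
      forall i, (i < n)%N -> M h`_i &
      integral4 (Poly f - Poly h0 * Poly h0) ->
      integral4 (Poly f - h * h) /\
      forall i, (i < j)%N -> M ((Poly f - h * h)`_(i + minn i n) / 4%:R)].

(** The recorded c equals h_n only modulo the maximal ideal, since the pass that records it also
    adds a multiple of 2 to h_n. *)
Definition marked (j n : nat) (h : {poly K}) (m : data K) : Prop :=
  (m = DNil /\ n = j) \/
  exists c, [/\ m = DCons (D (nseq n 0)) (DAtom c), (n < j)%N,
                ~~ M h`_n & M (c - h`_n)].

Definition refine_state (j : nat) (d : data K) : Prop :=
  exists (l : seq K) n m,
  [/\ d = DCons (D l) (DCons (D (nseq j 0)) m),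
      refined j n (Poly l) & marked j n (Poly l) m].

Lemma refined_PO j n h : refined j n h -> PO v h.
Proof.
case=> -[e Oe ->] _ _ _; apply: PO_add => //; apply: PO_scale => //.
exact: O_nat.
Qed.

Lemma refined_step j n h c : (j < size f)%N -> (n <= j)%N -> refined j n h ->
  O c ->
  (integral4 (Poly f - Poly h0 * Poly h0) ->
    M ((Poly f - h * h)`_(j + n) / 4%:R - c * h`_n
       - (if n == j then c * c else 0))) ->
  refined j.+1 n (h + (2%:R * c) *: 'X^j).
Proof.
move=> ltj lenj rh Oc cleanj; have Oh := refined_PO rh.
case: rh => -[e Oe Eh] szh lowh clean; split.
- exists (e + c *: 'X^j); last by rewrite scalerDr addrA -Eh scalerA.
  by apply: PO_add => //; apply: PO_scale => //; apply: PO_X.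
- apply: leq_trans (size_polyD _ _) _; rewrite geq_max szh.
  by apply: leq_trans (size_scale_leq _ _) _; rewrite size_polyXn.
- move=> i lti; rewrite coefD coefZ M_add ?lowh //.
  by rewrite -mulrA; apply: M_mull; rewrite ?M_2 // O_mul // coefXn O_nat.
- move=> C0; have [Og cl] := clean C0; split; first exact: refine_integral.
  by apply: refine_clean => //; apply: cleanj.
Qed.

(** For i <= j both min(i, j) and min(i, j + 1) are i, so the cleared positions stay the same when
    the search for a unit moves on. *)
Lemma refined_extend j h : refined j.+1 j h -> M h`_j -> refined j.+1 j.+1 h.
Proof.
case=> eh szh lowh clean Mj; split=> //.
  by move=> i; rewrite ltnS leq_eqVlt => /orP[/eqP->|/lowh].
move=> /clean[Og cl]; split=> // i lti; have := cl i lti.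
by rewrite (minn_idPl (ltnW lti)) (minn_idPl (lti : (i <= j)%N)).
Qed.

Lemma Poly_catrev_nseq j (a : seq K) : Poly (catrev (nseq j 0) a) = Poly a * 'X^j.
Proof.
elim: j a => [|j IH] a; first by rewrite mulr1.
by rewrite IH /= cons_poly_def addr0 exprS mulrA.
Qed.

(** Clearing position j + n of g / 4 is an equation for c: before a unit is met, n = j and c^2 + h_j
    c has to match it; afterwards n < j and the recorded unit times c does. *)
Lemma t_refine_stepP j d : (j < size f)%N -> refine_state j d ->
  refine_state j.+1 (ev [:: D f; d] t_refine_step).
Proof.
move=> ltj [l [n [m [-> rl mark]]]]; have n4 := four_neq0 hv.
have Ol := refined_PO rl.
have E4 : (1 + 1) * (1 + 1) = 4%:R :> K by ring.
rewrite /t_refine_step [ev _ _]/=.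
have [ll [-> Ell]] := t_mulP vle rt l l; rewrite t_axpyP t_nthP size_nseq.
set g := axpy _ _ _; rewrite t_dropP size_nseq.
have Eg : Poly g = Poly f - Poly l * Poly l.
  by rewrite Poly_axpy Ell scaleN1r addrC.
have coefg i : (drop j g)`_i = (Poly f - Poly l * Poly l)`_(j + i).
  by rewrite nth_drop -Eg coef_Poly.
set cd := (if truth m then _ else _).
have [c [Ec Oc cleanc]] : exists c, [/\ cd = DAtom c,
    integral4 (Poly f - Poly h0 * Poly h0) -> O c &
    integral4 (Poly f - Poly h0 * Poly h0) ->
      M ((Poly f - Poly l * Poly l)`_(j + n) / 4%:R - c * (Poly l)`_n
         - (if n == j then c * c else 0))].
  case: rl => _ _ lowl clean; case: mark => [[Em En]|[c0 [Em ltnj nMn Mc0]]].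
    rewrite /cd Em /= t_nthP size_nseq /= coefg En -(coef_Poly l) E4.
    set b := (Poly l)`_j; set y := (Poly f - _)`__; set c := rt _.
    have Ec : 4%:R * (c * c) + (4%:R * b) * c = y by apply: rt_quadratic.
    have Ey : y / 4%:R = c * c + b * c by rewrite -Ec; field.
    exists c; split=> //.
      by move=> /clean[Og _]; apply: (O_sqr hv (Ol j)); rewrite -Ey; apply: Og.
    by rewrite eqxx Ey -/b (_ : _ - _ - _ = 0) ?M_0 //; ring.
  rewrite /cd Em /= t_nthP size_nseq /= coefg E4.
  set y := (Poly f - _)`__; set c := rt _.
  have nMc0 : ~~ M c0 by rewrite (M_eqmod hv Mc0).
  have c00 := notM_neq0 hv nMc0.
  have Ec : (4%:R * c0) * c = y by apply: rt_linear; rewrite // mulf_neq0.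
  have Ey : y / 4%:R = c0 * c by rewrite -Ec; field.
  have Oc : integral4 (Poly f - Poly h0 * Poly h0) -> O c.
    move=> /clean[Og _]; have -> : c = c0^-1 * (y / 4%:R) by rewrite Ey mulKf.
    by apply: O_mul (O_inv hv nMc0) (Og _).
  exists c; split=> // /Oc {}Oc.
  rewrite (ltn_eqF ltnj) subr0 Ey mulrC -mulrBr; exact: M_mulr.
rewrite Ec /= (v_1 hv) -/(O c) /=.
(* The program skips a nonintegral c, which arises only if (f - h0^2) / 4 is not integral. *)
pose c' := if O c then c else 0.
have Oc' : O c' by rewrite /c'; case: ifP => // _; apply: O_0.
have rl' : refined j.+1 n (Poly l + (2%:R * c') *: 'X^j).
  have lenj : (n <= j)%N by case: mark => [[_ ->]|[c0 [_ /ltnW]]].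
  apply: refined_step => // C0; rewrite /c' Oc //; exact: cleanc.
set e := (if truth _ then _ else D l).
have [l' [-> El']] : exists l', e = D l' /\ Poly l' = Poly l + (2%:R * c') *: 'X^j.
  rewrite /e /c'; case: (O c) => /=; last first.
    by exists l; rewrite mulr0 scale0r addr0.
  rewrite -[DCons _ DNil]/(D [:: _]) t_catrevP t_axpyP; eexists; split=> //.
  rewrite Poly_axpy Poly_catrev_nseq /= cons_poly_def mul0r add0r scale1r.
  by rewrite mul_polyC addrC.
rewrite -El' in rl'; rewrite subrr -[DCons _ (D (nseq j 0))]/(D (nseq j.+1 0)).
(* The pass changes h by a multiple of 2 only, so its unit positions are kept. *)
have El'_n i : M ((Poly l')`_i - (Poly l)`_i).
  rewrite El' coefD addrAC subrr add0r coefZ -mulrA; apply: M_mull (M_2 hv) _ => //.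
  by rewrite O_mul // coefXn O_nat.
case: mark => [[Em En]|[c0 [Em ltnj nMn Mc0]]]; last first.
  exists l', n, m; rewrite Em; split=> //; right; exists c0; split=> //.
  - exact: leqW.
  - by rewrite (M_eqmod hv (El'_n n)).
  - by rewrite -(subrK (Poly l)`_n c0) -addrA M_add // -opprB M_opp.
rewrite {}Em {}En /= in rl' *.
case: (boolP (v l`_j <= 0)%E) => [le0|lt0] /=.
  exists l', j, (DCons (D (nseq j 0)) (DAtom l`_j)); split=> //.
  right; exists l`_j; split=> //.
  - by rewrite (M_eqmod hv (El'_n j)) coef_Poly /vmax -leNgt.
  - by rewrite -(coef_Poly l) -opprB M_opp.
exists l', j.+1, DNil; split=> //; last by left.
apply: refined_extend => //; rewrite (M_eqmod hv (El'_n j)) coef_Poly.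
by rewrite /vmax ltNge.
Qed.
#[global] Opaque t_refine_step.

Lemma t_refineP : (size (Poly h0) <= size f)%N ->
  exists l n m, [/\ ev [:: D f; D h0] t_refine = D l,
    refined (size f) n (Poly l) & marked (size f) n (Poly l) m].
Proof.
move=> szh; rewrite /t_refine [ev _ _]/=.
set d := dfold _ _ _; have : refine_state (size f) d.
  apply: (dfold_ind (P := refine_state)) => [|i r d' x]; last exact: t_refine_stepP.
  exists h0, 0%N, DNil; split=> //; last by left.
  split=> //; exists 0; last by rewrite scaler0 addr0.
  by move=> i; rewrite coef0 O_0.
by case=> l [n [m [-> rl mark]]]; exists l, n, m.
Qed.
#[global] Opaque t_refine.

End RefinementProgram.

(** * The complete algorithm *)

Lemma valued_closure_dyadic (R1 : idomainType) (K : closedFieldType)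
    (iota : {rmorphism {fraction R1} -> K}) (RR : realType) (v : K -> \bar RR) :
  valued_closure iota v -> dyadic_valuation v.
Proof.
move=> hv; split.
- exact: vc_v0 hv.
- by move=> x /(vc_rational hv)[q ->]; exists (ratr q).
- exact: vc_vM hv.
- exact: vc_vD hv.
- exact: vc_v2 hv.
Qed.

Lemma laurent_val0_unit (K : fieldType) (RR : realType) (v : K -> \bar RR)
    (f : {poly K}) : dyadic_valuation v ->
  laurent_val v (laurent_of_poly f) = 0%E -> exists k, ~~ vmax v f`_k.
Proof.
move=> hv vf0; have [f0|f0] := eqVneq f 0.
  suff : (+oo <= laurent_val v (laurent_of_poly f))%E by rewrite vf0.
  by apply: le_ereal_inf_tmp => _ [[n|n] _ <-]; rewrite /= ?f0 ?coef0 (dv_0 hv).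
have [k [fk0 fmin]] := min_coef hv f0.
by exists k; rewrite /vmax -(laurent_val_min hv fk0 fmin) vf0 ltxx.
Qed.

(** Both steps always run. If (f - l0^2) / 4 is not integral, the refinement has merely added a
    multiple of 2 to l0, and [odd_after_refinement] applies. *)
Lemma t_optimalP (K : fieldType) (RR : realType) (v : K -> \bar RR) (S : set K)
    (rt : {poly K} -> K) (f : {poly K}) :
  dyadic_valuation v -> (forall x, vring v x <-> S x) -> root_extraction rt ->
  PO v f -> laurent_val v (laurent_of_poly f) = 0%E ->
  exists l g : seq K,
    tev (fun x y => (v x <= v y)%E) rt [:: data_of_seq f] t_optimal =
      DCons (data_of_seq l) (data_of_seq g) /\
    optimal_decomposition S v (laurent_of_poly f) (laurent_of_poly (Poly l))
      (laurent_of_poly (Poly g)).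
Proof.
move=> hv hS hrt Of vf0; have [k nMfk] := laurent_val0_unit hv vf0.
have f0 : polyseq f != [::].
  by apply: contraNneq nMfk => ->; rewrite nth_nil (M_0 hv).
rewrite /t_optimal [tev _ _ _ _]/=.
have [l0 [-> szl0 even]] := t_oddP hv hrt f0; rewrite polyseqK in even.
have Ol0 := PO_sqrt_even hv Of even.
have [l [n [m [-> rl mark]]]] := t_refineP hv hrt Ol0 szl0.
have [ll [-> Ell]] := t_mulP (fun x y => (v x <= v y)%E) rt l l.
rewrite t_axpyP; eexists; eexists; split; first reflexivity.
have -> : Poly (axpy (-1) ll f) = f - Poly l * Poly l.
  by rewrite Poly_axpy Ell polyseqK scaleN1r addrC.
have Ol := refined_PO hv Ol0 rl.
case: rl; rewrite polyseqK => -[e Oe El] szl lowl clean.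
have [C0|nC0] := pselect (forall i, vring v ((f - Poly l0 * Poly l0)`_i / 4%:R)).
  have [Og cleang] := clean C0; have Ef : f = Poly l * Poly l + (f - Poly l * Poly l).
    by rewrite addrC subrK.
  have f_gt0 : (0 < size f)%N by rewrite lt0n size_eq0.
  have ltf j : (j <= (size f).-1)%N -> (j < size f)%N by rewrite -ltnS prednK.
  (* Without a recorded unit, n is the size of f and l has only nonunit coefficients; then so has f,
     which is l^2 plus a multiple of 4, against v(f) = 0. *)
  have nMn : ~~ vmax v (Poly l)`_n.
    case: mark => [[_ En]|[c [_ _ ]] //]; case/negP: nMfk.
    have Ml i : vmax v (Poly l)`_i.
      have [ltin|leni] := ltnP i n; first exact: lowl.
      by rewrite nth_default ?(M_0 hv) // (leq_trans szl) // -En.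
    rewrite Ef coefD (M_add hv) //; first exact: PM_mul.
    rewrite -[X in vmax v X](divfK (four_neq0 hv)) (M_mulr hv) //.
    by rewrite (natrM _ 2 2) (M_mull hv) ?(M_2 hv) // (O_nat hv).
  apply: (clean_decomposition_optimal hv hS (n := n) (J := (size f).-1)) => //.
  - by rewrite prednK.
  - apply: leq_trans (size_polyD _ _) _; rewrite size_polyN geq_max.
    apply/andP; split; first by move: (size f) f_gt0 => a; lia.
    apply: leq_trans (size_polyMleq _ _) _.
    by move: (size f) (size (Poly l)) szl f_gt0 => a b; lia.
  - by move=> j /ltf; apply: cleang.
rewrite El; apply: odd_after_refinement => //.
- by have /existsNP[i /negP nO] := nC0; exists i.
- move=> x; exists (rt (Poly [:: - x; 0; 1])).
  exact: rt_sqrt.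
Qed.

Lemma root_extraction_exists (K : closedFieldType) :
  exists rt : {poly K} -> K, root_extraction rt.
Proof.
have /choice[rt hrt] : forall p : {poly K}, exists x, (1 < size p)%N -> root p x.
  move=> p; have [sz|] := ltnP 1 (size p); last by exists 0.
  have /closed_rootP[x px] : size p != 1%N by rewrite gtn_eqF.
  by exists x.
by exists rt.
Qed.

Theorem proposition3p2p8 :
  exists c : command,
  forall (R1 : idomainType) (K : closedFieldType)
    (iota : {rmorphism {fraction R1} -> K})
    (RR : realType) (v : K -> \bar RR),
  valued_closure iota v ->
  forall f : {poly K},
    (forall i : nat, integral_closure iota f`_i) ->
    laurent_val v (laurent_of_poly f) = 0%E ->
    (exists h g : {poly K},
       optimal_decomposition (integral_closure iota) v
         (laurent_of_poly f) (laurent_of_poly h) (laurent_of_poly g)) /\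
    (forall rt : {poly K} -> K, root_extraction rt ->
     exists h g : {poly K},
       computes (fun x y => (v x <= v y)%E) rt c f h g /\
       optimal_decomposition (integral_closure iota) v
         (laurent_of_poly f) (laurent_of_poly h) (laurent_of_poly g)).
Proof.
(* The environment is variable 0 alone, so the result is left in variable 1. *)
exists (CSeq (compile 0 1 t_optimal) (CAssign 0 (EVar 1))).
move=> R1 K iota RR v hv f Of vf0.
have hd := valued_closure_dyadic hv; have hS := vc_ring hv.
have POf : PO v f by move=> i; apply/hS.
suff computed : forall rt : {poly K} -> K, root_extraction rt ->
     exists h g : {poly K},
       computes (fun x y => (v x <= v y)%E) rt
         (CSeq (compile 0 1 t_optimal) (CAssign 0 (EVar 1))) f h g /\
       optimal_decomposition (integral_closure iota) v
         (laurent_of_poly f) (laurent_of_poly h) (laurent_of_poly g).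
  (* Existence follows by running the program with any root function, which exists by choice. *)
  split=> //; have [rt /computed[h [g [_ opt]]]] := root_extraction_exists K.
  by exists h, g.
move=> rt hrt; have [l [g [Elg opt]]] := t_optimalP hd hS hrt POf vf0.
exists (Poly l), (Poly g); split=> //.
have env0 : holds_env (input_store (data_of_seq f)) 0 [:: data_of_seq f] by case.
have [s [ex val _]] :=
  compile_correct (fun x y => (v x <= v y)%E) rt t_optimal env0.
exists (update s 0%N (s 1%N)), l, g; split=> //.
  exact: exec_seq ex (exec_assign _ _ _ _ _).
by rewrite update_eq -Elg -val.
Qed.
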